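(* Let $\alpha,\beta>0$, $n\ge 4$ and $1\le p\le n$. Then there exist two lattices $\Lambda_1$ and $\Lambda_2$ in $\mathbb{R}^n$ such that $F_{\alpha\beta,p}^{\mathbb{R}^n/\Lambda_1}$ and $F_{\alpha\beta,p}^{\mathbb{R}^n/\Lambda_2}$ are isospectral, whereas the flat tori $\mathbb{R}^n/\Lambda_1$ and $\mathbb{R}^n/\Lambda_2$ are not isometric.
   Context: A lattice in $\mathbb{R}^n$ is the $\mathbb{Z}$-span of a basis of $\mathbb{R}^n$; $\mathbb{R}^n/\Lambda$ carries the flat metric induced by the standard metric of $\mathbb{R}^n$. For a compact Riemannian manifold $M$, $d$ is the exterior derivative, $\delta$ its formal $L^2$-adjoint, and $F_{\alpha\beta,p}^M:=\alpha d\delta+\beta\delta d$ on smooth $p$-forms. Its spectrum is the function assigning to each $\lambda\in\mathbb{C}$ the dimension of $\{\omega\in\Omega^p(M)\mid F_{\alpha\beta,p}^M\omega=\lambda\omega\}$. Two operators are isospectral if their spectra (with multiplicities) coincide. *)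

(* Defs.v *)
From HB Require Import structures.
From mathcomp Require Import all_boot all_order all_algebra.
From mathcomp Require Import complex.
From mathcomp Require Import all_classical all_reals all_analysis.

Set Implicit Arguments.
Unset Strict Implicit.
Unset Printing Implicit Defensive.

Import Order.TTheory GRing.Theory Num.Theory.
Import numFieldNormedType.Exports.

Local Open Scope classical_set_scope.
Local Open Scope complex_scope.
Local Open Scope ring_scope.

(* A lattice is given by a basis of R^n, namely the rows of an invertible     *)
(* matrix B. Objects on the torus R^n / (lattice B) are given by their lifts  *)
(* to R^n; vectors are row vectors.                                           *)
Definition lattice (R : realType) (n : nat) (B : 'M[R]_n) : set 'rV[R]_n :=
  range (fun z : 'rV[int]_n => map_mx intr z *m B).

Definition torus_eq (R : realType) (n : nat) (B : 'M[R]_n) (x y : 'rV[R]_n) :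
  Prop := lattice B (x - y).

Definition partial (R : realType) (n : nat) (j : 'I_n) (f : 'rV[R]_n -> R) :
  'rV[R]_n -> R := 'D_(delta_mx 0 j) f.

(* C^oo on U: every iterated partial derivative exists and is continuous at   *)
(* every point of U (only used with U open).                                  *)
Definition smooth_on (R : realType) (n : nat) (U : set 'rV[R]_n)
    (f : 'rV[R]_n -> R) : Prop :=
  forall (s : seq 'I_n) (x : 'rV[R]_n), U x ->
    {for x, continuous (foldr (@partial R n) f s)} /\
    forall j : 'I_n, derivable (foldr (@partial R n) f s) x (delta_mx 0 j).

(* Complex-valued differential forms on R^n, of mixed degree: w I is the      *)
(* coefficient of dx_{i_1} /\ ... /\ dx_{i_p}, I = {i_1 < ... < i_p}.         *)
Definition dform (R : realType) (n : nat) : Type :=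
  {set 'I_n} -> 'rV[R]_n -> R[i].

Definition cpartial (R : realType) (n : nat) (j : 'I_n)
    (f : 'rV[R]_n -> R[i]) (x : 'rV[R]_n) : R[i] :=
  (partial j (fun y => complex.Re (f y)) x) +i*
  (partial j (fun y => complex.Im (f y)) x).

(* Omega^*(R^n / lattice B) = direct sum of the spaces of smooth p-forms.     *)
Definition torus_form (R : realType) (n : nat) (B : 'M[R]_n) (w : dform R n) :
  Prop :=
  forall I : {set 'I_n},
    [/\ smooth_on setT (fun x => complex.Re (w I x)),
        smooth_on setT (fun x => complex.Im (w I x)) &
        forall x y, torus_eq B x y -> w I x = w I y].

Definition torus_pform (R : realType) (n : nat) (B : 'M[R]_n) (p : nat)
    (w : dform R n) : Prop :=
  torus_form B w /\ forall (I : {set 'I_n}) x, #|I| <> p -> w I x = 0.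

(* The sign comes from dx_j /\ dx_{J :\ j} = (-1)^#{i in J | i < j} dx_J.     *)
Definition ext_d (R : realType) (n : nat) (w : dform R n) : dform R n :=
  fun J x =>
    \sum_(j in J)
       (-1) ^+ #|[pred i in J | (i < j)%N]| * cpartial j (w (J :\ j)) x.

(* Integral over the unit cube [0,1]^n, as an iterated Lebesgue integral.     *)
Fixpoint cube_integral (R : realType) (n : nat) : ('rV[R]_n -> R) -> R :=
  match n return ('rV[R]_n -> R) -> R with
  | 0 => fun f => f 0
  | m.+1 => fun f =>
      \int[@lebesgue_measure R]_(t in `[0, 1])
        cube_integral (fun v : 'rV[R]_m => f (row_mx (t%:M : 'rV[R]_1) v))
  end.

(* Integral over R^n / lattice B for the Riemannian volume: integrate over    *)
(* the fundamental parallelotope, parametrized by the unit cube.              *)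
Definition torus_integral (R : realType) (n : nat) (B : 'M[R]_n)
    (f : 'rV[R]_n -> R) : R :=
  `|\det B| * cube_integral (fun t => f (t *m B)).

Definition torus_cintegral (R : realType) (n : nat) (B : 'M[R]_n)
    (f : 'rV[R]_n -> R[i]) : R[i] :=
  (torus_integral B (fun x => complex.Re (f x))) +i*
  (torus_integral B (fun x => complex.Im (f x))).

(* For the flat metric the dx_I are pointwise orthonormal.                    *)
Definition form_inner (R : realType) (n : nat) (B : 'M[R]_n)
    (w1 w2 : dform R n) : R[i] :=
  torus_cintegral B (fun x => \sum_(I : {set 'I_n}) w1 I x * (w2 I x)^*%C).

Definition zero_form (R : realType) (n : nat) : dform R n := fun _ _ => 0.

(* The value at w of the formal L^2-adjoint of ext_d on Omega^*; a junk value *)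
(* is returned when there is no such value, e.g. when w is not smooth.        *)
Definition codiff (R : realType) (n : nat) (B : 'M[R]_n) (w : dform R n) :
  dform R n :=
  xget (@zero_form R n)
    [set eta | torus_form B eta /\
      forall theta : dform R n, torus_form B theta ->
        form_inner B (ext_d theta) w = form_inner B theta eta].

Definition F_op (R : realType) (n : nat) (B : 'M[R]_n) (alpha beta : R)
    (w : dform R n) : dform R n :=
  fun J x => alpha%:C * ext_d (codiff B w) J x
             + beta%:C * codiff B (ext_d w) J x.

Definition F_eigenspace (R : realType) (n : nat) (B : 'M[R]_n)
    (alpha beta : R) (p : nat) (lambda : R[i]) : set (dform R n) :=
  [set w | torus_pform B p w /\
           forall J x, F_op B alpha beta w J x = lambda * w J x].

Definition form_comb (R : realType) (n k : nat) (c : 'I_k -> R[i])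
    (e : 'I_k -> dform R n) : dform R n :=
  fun J x => \sum_(i < k) c i * e i J x.

Definition form_basis (R : realType) (n k : nat) (E : set (dform R n))
    (e : 'I_k -> dform R n) : Prop :=
  [/\ forall i, E (e i),
      forall c : 'I_k -> R[i],
        form_comb c e = @zero_form R n -> forall i, c i = 0 &
      forall w, E w -> exists c : 'I_k -> R[i], w = form_comb c e].

(* Complex dimension of a subspace E; None stands for infinite dimension.     *)
Definition form_dim (R : realType) (n : nat) (E : set (dform R n)) :
  option nat :=
  xget None
    [set Some k | k in [set k : nat | exists e : 'I_k -> dform R n,
                                        form_basis E e]].

Definition F_spectrum (R : realType) (n : nat) (B : 'M[R]_n)
    (alpha beta : R) (p : nat) : R[i] -> option nat :=
  fun lambda => form_dim (F_eigenspace B alpha beta p lambda).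

Definition F_isospectral (R : realType) (n : nat) (B1 B2 : 'M[R]_n)
    (alpha beta : R) (p : nat) : Prop :=
  forall lambda : R[i],
    F_spectrum B1 alpha beta p lambda = F_spectrum B2 alpha beta p lambda.

(* A map between tori is given by a map f on representatives. As              *)
(* R^n -> R^n / lattice B is a local isometry, smoothness and the pulled back *)
(* metric of such a map are read off local lifts: F is a smooth lift of f     *)
(* over the open set U.                                                       *)
Definition torus_map (R : realType) (n : nat) (B1 B2 : 'M[R]_n)
    (f : 'rV[R]_n -> 'rV[R]_n) : Prop :=
  forall x y, torus_eq B1 x y -> torus_eq B2 (f x) (f y).

Definition smooth_lift (R : realType) (n : nat) (B2 : 'M[R]_n)
    (f : 'rV[R]_n -> 'rV[R]_n) (U : set 'rV[R]_n)
    (F : 'rV[R]_n -> 'rV[R]_n) : Prop :=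
  [/\ open U,
      forall y, U y -> torus_eq B2 (F y) (f y) &
      forall j : 'I_n, smooth_on U (fun y => F y 0 j)].

Definition torus_smooth (R : realType) (n : nat) (B1 B2 : 'M[R]_n)
    (f : 'rV[R]_n -> 'rV[R]_n) : Prop :=
  torus_map B1 B2 f /\
  forall x, exists (U : set 'rV[R]_n) (F : 'rV[R]_n -> 'rV[R]_n),
    U x /\ smooth_lift B2 f U F.

Definition diff_mx (R : realType) (n : nat) (F : 'rV[R]_n -> 'rV[R]_n)
    (y : 'rV[R]_n) : 'M[R]_n :=
  \matrix_(i, j) partial i (fun z => F z 0 j) y.

(* f is a diffeomorphism with inverse g, and f pulls the flat metric back to  *)
(* the flat metric.                                                           *)
Definition torus_isometry (R : realType) (n : nat) (B1 B2 : 'M[R]_n)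
    (f g : 'rV[R]_n -> 'rV[R]_n) : Prop :=
  [/\ torus_smooth B1 B2 f, torus_smooth B2 B1 g,
      forall x, torus_eq B1 (g (f x)) x,
      forall y, torus_eq B2 (f (g y)) y &
      forall U F, smooth_lift B2 f U F ->
        forall y, U y -> diff_mx F y *m (diff_mx F y)^T = 1%:M].

Definition tori_isometric (R : realType) (n : nat) (B1 B2 : 'M[R]_n) : Prop :=
  exists f g : 'rV[R]_n -> 'rV[R]_n, torus_isometry B1 B2 f g.

(* Main.v *)
Require Import Defs.
From HB Require Import structures.
From mathcomp Require Import all_boot all_order all_algebra.
From mathcomp Require Import complex.
From mathcomp Require Import all_classical all_reals all_analysis.
From mathcomp Require Import ring lra zify.

Set Implicit Arguments.
Unset Strict Implicit.
Unset Printing Implicit Defensive.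

Import Order.TTheory GRing.Theory Num.Theory.
Import numFieldNormedType.Exports.

Local Open Scope classical_set_scope.
Local Open Scope complex_scope.
Local Open Scope ring_scope.

(** Two flat tori are isospectral for [alpha d delta + beta delta d] as soon as their
    dual lattices have the same number of vectors of each length, because on the
    Fourier modes of frequency [mu] the operator acts on the constant forms by the
    scalars [4 pi^2 alpha |mu|^2] and [4 pi^2 beta |mu|^2], with multiplicities
    that depend on [n] and [p] only. The tetralattices of Conway and Sloane, a
    4-parameter family of pairs of lattices in dimension 4, have this property.
    Orthogonally to them, the same scaled integer lattice is added to both to reach
    dimension [n].

    Each vector of the lattices reduces modulo 3 to a word of the tetracode, which
    vanishes in one coordinate only or is zero. Changing the sign of a coordinate
    divisible by 3 maps a vector of one lattice to a vector of the other, so a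
    length-preserving bijection of the dual lattices changes the sign of one
    coordinate, which one depending on the class modulo 3. This bijection is linear on each class, and the
    classes are cut out by averaging over translations of order 3 of the torus. The
    corresponding operator on forms is therefore a finite combination of pullbacks
    by translations and coordinate reflections ([tetra_transplant]). It is defined
    on all forms, commutes with [d] and [delta], exchanges the forms of the two tori
    ([periodic_transplant]) and is an involution on them ([transplant_involutive],
    [tetra_transplantK]). It carries bases of eigenspaces to bases of eigenspaces,
    so that neither Fourier series nor the finiteness of the multiplicities enters.

    Commuting with [delta], which is defined by adjunction, requires its closed form
    ([codiffE]): the explicit operator is adjoint to [d] because partial derivatives
    of periodic functions integrate to 0 ([torus_integral_partial]), and the adjoint
    is unique because a nonnegative periodic function with integral 0 vanishes
    ([torus_integral_eq0]).

    To tell the tori apart, an isometry is lifted to a linear isometry mapping the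
    first lattice into the second ([torus_isometry_linear]): a local lift has an
    orthogonal Jacobian, hence is affine ([orthogonal_jacobian_affine]), and the
    local lifts agree by discreteness of the lattice. The squared lengths of the
    four axes are 1, sqrt 2, sqrt 3 and sqrt 6. Being independent over the
    rationals, they force such a linear map to change only signs of coordinates on
    the vectors that matter; no choice of signs is compatible with both the
    tetracode and the parity condition of the second lattice
    ([tetra_not_isometric]). *)

(** * Calculus along coordinate directions *)

Lemma is_derive_line (R : realType) (n : nat) (f : 'rV[R]_n -> R)
    (x v : 'rV[R]_n) (t : R) :
  derivable f (x + t *: v) v ->
  is_derive t 1 (fun s => f (x + s *: v)) ('D_v f (x + t *: v)).
Proof.
move=> df.
have E : (fun h : R => h^-1 *: (((fun s => f (x + s *: v)) \o shift t) (h *: 1)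
            - f (x + t *: v))) =
         (fun h : R => h^-1 *: ((f \o shift (x + t *: v)) (h *: v)
            - f (x + t *: v))).
  apply/funext => h /=; congr (_ *: (f _ - _)).
  by rewrite scalerDl [h *: 1]mulr1 addrCA.
by split; rewrite /derivable /derive E.
Qed.

Lemma MVT_coord (R : realType) (n : nat) (f : 'rV[R]_n -> R)
    (x v : 'rV[R]_n) (a b : R) :
  a <= b ->
  (forall t, a <= t <= b -> derivable f (x + t *: v) v) ->
  exists2 c, a <= c <= b &
    f (x + b *: v) - f (x + a *: v) = 'D_v f (x + c *: v) * (b - a).
Proof.
move=> ab df.
have [t|| c cab ->] := @MVT_segment R (fun s => f (x + s *: v))
   (fun s => 'D_v f (x + s *: v)) a b ab.
- rewrite in_itv /= => /andP[a_t t_b]; apply: is_derive_line.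
  by apply: df; rewrite !ltW.
- apply: derivable_within_continuous => t; rewrite in_itv /= => tab.
  by have [] := is_derive_line (df _ tab).
- by exists c => //; move: cab; rewrite in_itv.
Qed.

(** Domains that contain, with two points, the coordinatewise path between them;
    such a path is what partial derivatives alone control. *)
Definition box (R : realType) (n : nat) (Q : set 'rV[R]_n) : Prop :=
  forall x y z : 'rV[R]_n, Q x -> Q y ->
    (forall j, (x 0 j <= z 0 j <= y 0 j) || (y 0 j <= z 0 j <= x 0 j)) -> Q z.

Lemma boxT (R : realType) (n : nat) : box (@setT 'rV[R]_n).
Proof. by []. Qed.

(** The norm of row vectors is the sup norm, so balls are cubes. *)
Lemma rV_ballP (R : realType) (n : nat) (x y : 'rV[R]_n) (e : R) :
  0 < e -> (ball x e y <-> forall j, `|x 0 j - y 0 j| < e).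
Proof.
move=> e0; rewrite -ball_normE /ball_ /= [`|_|]mx_normrE; split.
- move=> H j; apply: le_lt_trans H.
  have -> : `|x 0 j - y 0 j| = (fun i : 'I_1 * 'I_n => `|(x - y) i.1 i.2|) (0, j).
    by rewrite /= !mxE.
  exact: le_bigmax.
- move=> H; apply: bigmax_lt => //= -[i j] _ /=.
  by rewrite !mxE ord1.
Qed.

Lemma box_ball (R : realType) (n : nat) (x : 'rV[R]_n) (e : R) :
  0 < e -> box (ball x e).
Proof.
move=> e0 y z u /(rV_ballP _ _ e0) By /(rV_ballP _ _ e0) Bz H.
apply/rV_ballP => // j; move: (By j) (Bz j) (H j).
by rewrite !ltr_norml => /andP[? ?] /andP[? ?] /orP[] /andP[? ?]; lra.
Qed.

(** Go from [y] to [x] by changing one coordinate at a time, and apply the mean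
    value theorem to each step. No differentiability of [f] as a function of
    several variables is involved. *)
Lemma box_lipschitz (R : realType) (n : nat) (Q : set 'rV[R]_n)
    (f : 'rV[R]_n -> R) (K : R) :
  box Q ->
  (forall x j, Q x -> derivable f x (delta_mx 0 j)) ->
  (forall x j, Q x -> `|partial j f x| <= K) ->
  forall x y, Q x -> Q y -> `|f x - f y| <= K * \sum_j `|x 0 j - y 0 j|.
Proof.
move=> boxQ df dK x y Qx Qy.
pose z k : 'rV[R]_n := \row_j if (j < k)%N then x 0 j else y 0 j.
have btw (a b : R) : (a <= a <= b) || (b <= a <= a) by rewrite !lexx andbT le_total.
have Qz k : Q (z k).
  apply: (boxQ x y) => // j; rewrite mxE; case: ifP => _; first exact: btw.
  by rewrite orbC btw.
have -> : x = z n by apply/rowP => j; rewrite mxE ltn_ord.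
have E0 : y = z 0%N by apply/rowP => j; rewrite mxE.
rewrite {1}E0.
have -> : f (z n) - f (z 0%N) = \sum_(j < n) (f (z j.+1) - f (z j)).
  by rewrite -(big_mkord xpredT (fun k => f (z k.+1) - f (z k))) telescope_sumr.
apply: le_trans (ler_norm_sum _ _ _) _; rewrite mulr_sumr.
apply: ler_sum => j _.
pose e : 'rV[R]_n := delta_mx 0 j.
pose z' : 'rV[R]_n := \row_i if i == j then 0 else z j 0 i.
(* [z'] is [z j] with coordinate [j] erased, so both [z j] and [z j.+1] lie on
   the line through [z'] in direction [j]. *)
have zz t : z' + t *: e = \row_i if i == j then t else z j 0 i.
  apply/rowP => i; rewrite !mxE eqxx /=; case: (i == j) => /=;
  by rewrite ?add0r ?mulr1 ?mulr0 ?addr0.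
have z1 : z j.+1 = z' + x 0 j *: e.
  rewrite zz; apply/rowP => i; rewrite !mxE ltnS leq_eqVlt val_eqE.
  by case: eqVneq => [->|ij].
have z2 : z j = z' + y 0 j *: e.
  rewrite zz; apply/rowP => i; rewrite !mxE.
  by case: eqVneq => [->|ij] //=; rewrite ltnn.
have -> : z n 0 j = x 0 j by rewrite mxE ltn_ord.
have main a b : a <= b -> Q (z' + a *: e) -> Q (z' + b *: e) ->
    `|f (z' + b *: e) - f (z' + a *: e)| <= K * (b - a).
  move=> ab Qa Qb.
  have Qt t : a <= t <= b -> Q (z' + t *: e).
    move=> tab; apply: (boxQ _ _ _ Qa Qb) => i; rewrite !zz !mxE.
    by case: ifP => _; rewrite ?tab ?lexx.
  have [t tab|c cab ->] := @MVT_coord R n f z' e a b ab.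
    exact/df/Qt.
  by rewrite normrM [`|b - a|]ger0_norm ?subr_ge0// ler_wpM2r ?subr_ge0// dK//; exact: Qt.
rewrite z1 z2; case: (leP (x 0 j) (y 0 j)) => [xy|/ltW yx].
- rewrite distrC [`|x 0 j - _|]distrC [`|y 0 j - _|]ger0_norm ?subr_ge0//.
  by apply: main => //; rewrite -?z1 -?z2.
- rewrite [`|x 0 j - _|]ger0_norm ?subr_ge0//.
  by apply: main => //; rewrite -?z1 -?z2.
Qed.

Lemma box_partial0_cst (R : realType) (n : nat) (Q : set 'rV[R]_n)
    (f : 'rV[R]_n -> R) :
  box Q ->
  (forall x j, Q x -> derivable f x (delta_mx 0 j)) ->
  (forall x j, Q x -> partial j f x = 0) ->
  forall x y, Q x -> Q y -> f x = f y.
Proof.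
move=> bQ df d0 x y Qx Qy; apply/eqP; rewrite -subr_eq0 -normr_le0.
have := box_lipschitz (K := 0) bQ df _ Qx Qy.
by rewrite mul0r; apply => z j Qz; rewrite d0 // normr0.
Qed.

(** * Maps with orthogonal Jacobian *)

Lemma smooth_on_partial (R : realType) (n : nat) (U : set 'rV[R]_n)
    (f : 'rV[R]_n -> R) (j : 'I_n) :
  smooth_on U f -> smooth_on U (partial j f).
Proof. by move=> sf s x Ux; have := sf (rcons s j) x Ux; rewrite foldr_rcons. Qed.

Lemma smooth_on_continuous (R : realType) (n : nat) (U : set 'rV[R]_n)
    (f : 'rV[R]_n -> R) (x : 'rV[R]_n) :
  smooth_on U f -> U x -> {for x, continuous f}.
Proof. by move=> sf Ux; have [] := sf [::] x Ux. Qed.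

Lemma smooth_on_derivable (R : realType) (n : nat) (U : set 'rV[R]_n)
    (f : 'rV[R]_n -> R) (x : 'rV[R]_n) (j : 'I_n) :
  smooth_on U f -> U x -> derivable f x (delta_mx 0 j).
Proof. by move=> sf Ux; have [] := sf [::] x Ux. Qed.

Lemma derivable_translate (R : realType) (n : nat) (f : 'rV[R]_n -> R)
    (x v w : 'rV[R]_n) :
  derivable (fun y => f (y + w)) x v = derivable f (x + w) v.
Proof. by rewrite /derivable; under eq_fun do rewrite /= -addrA. Qed.

Lemma derive_translate (R : realType) (n : nat) (f : 'rV[R]_n -> R)
    (x v w : 'rV[R]_n) :
  'D_v (fun y => f (y + w)) x = 'D_v f (x + w).
Proof. by rewrite /derive; under eq_fun do rewrite /= -addrA. Qed.

(** Two successive uses of the mean value theorem, in direction [i] and then in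
    direction [j]. *)
Lemma second_difference (R : realType) (n : nat) (U : set 'rV[R]_n)
    (f : 'rV[R]_n -> R) (x : 'rV[R]_n) (i j : 'I_n) (h : R) :
  smooth_on U f -> 0 <= h ->
  let p s t := x + s *: delta_mx 0 i + t *: delta_mx 0 j in
  (forall s t, 0 <= s <= h -> 0 <= t <= h -> U (p s t)) ->
  exists s t, [/\ 0 <= s <= h, 0 <= t <= h &
    f (p h h) - f (p h 0) - (f (p 0 h) - f (p 0 0)) =
    partial j (partial i f) (p s t) * h * h].
Proof.
move=> sf h0 p Up; set ei := delta_mx 0 i in p Up *; set ej := delta_mx 0 j in p Up *.
have pE s t : x + s *: ei + t *: ej = p s t by [].
have p0E s : x + s *: ei = p s 0 by rewrite /p scale0r addr0.
have hh : 0 <= h <= h by rewrite h0 lexx.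
have h0h : 0 <= (0 : R) <= h by rewrite h0 lexx.
pose g (y : 'rV[R]_n) := f (y + h *: ej) - f y.
have d1 s : 0 <= s <= h -> derivable (fun y => f (y + h *: ej)) (p s 0) ei.
  move=> sh; rewrite derivable_translate -p0E pE; apply: smooth_on_derivable sf _.
  exact: Up.
have d2 s : 0 <= s <= h -> derivable f (p s 0) ei.
  by move=> sh; apply: smooth_on_derivable sf _; exact: Up.
have [s sh|s sh E1] := @MVT_coord R n g x ei 0 h h0.
  by rewrite p0E; apply: derivableB; [exact: d1|exact: d2].
have [t th|t th E2] := @MVT_coord R n (partial i f) (p s 0) ej 0 h h0.
  rewrite -p0E pE; apply: (@smooth_on_derivable _ _ U); first exact: smooth_on_partial sf.
  exact: Up.
exists s, t; split => //.
have p0j t' s' : p s' 0 + t' *: ej = p s' t' by rewrite -p0E.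
have Dg : 'D_ei g (p s 0) = partial i f (p s h) - partial i f (p s 0).
  rewrite deriveB; [|exact: d1|exact: d2].
  by rewrite derive_translate p0j.
move: E1 E2; rewrite !subr0 !p0E !p0j Dg => E1 E2.
by rewrite -[partial j _ _ * h]E2 -E1 /g !p0j opprB addrA.
Qed.

(** Schwarz's theorem. The second difference of [f] over a small square is
    symmetric in the two directions, and equals each of the two mixed
    derivatives at some point of the square. *)
Lemma partialC (R : realType) (n : nat) (U : set 'rV[R]_n)
    (f : 'rV[R]_n -> R) (x : 'rV[R]_n) (i j : 'I_n) :
  open U -> smooth_on U f -> U x ->
  partial j (partial i f) x = partial i (partial j f) x.
Proof.
move=> oU sf Ux; apply/eqP; rewrite -subr_eq0; apply/negPn/negP => ab0.
set a := partial j _ x in ab0; set b := partial i _ x in ab0.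
pose eps := `|a - b| / 2; have eps0 : 0 < eps by rewrite divr_gt0 ?normr_gt0.
have C u v : \forall y \near x, `|partial v (partial u f) x - partial v (partial u f) y| < eps.
  have : {for x, continuous (partial v (partial u f))}.
    by apply: smooth_on_continuous Ux; do 2 apply: smooth_on_partial.
  by move=> /cvgr_dist_lt; apply.
have nU : nbhs x U by exact: open_nbhs_nbhs.
have [e /= e0 He] := (nbhs_ballP _ _).1 (filterI (filterI (C i j) (C j i)) nU).
have [h h0 hE] : exists2 h : R, 0 <= h & e = 3 * h by exists (e / 3); lra.
have B (k l : 'I_n) (s t : R) : 0 <= s <= h -> 0 <= t <= h ->
    ball x e (x + s *: delta_mx 0 k + t *: delta_mx 0 l).
  move=> sh th; apply/rV_ballP => // m; rewrite !mxE eqxx /=.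
  have bnd (b1 : bool) (r : R) : 0 <= r <= h -> 0 <= r * b1%:R <= h.
    by case: b1; rewrite ?mulr1 ?mulr0 // lexx h0.
  move: (bnd (m == k) s sh) (bnd (m == l) t th); move: (_ * _) (_ * _) => u v.
  move=> /andP[? ?] /andP[? ?]; by rewrite ltr_norml; apply/andP; split; lra.
have [s [t [sh th E1]]] := second_difference sf h0
  (fun s t hs ht => (He _ (B i j s t hs ht)).2).
have [s' [t' [sh' th' E2]]] := second_difference sf h0
  (fun s t hs ht => (He _ (B j i s t hs ht)).2).
have := (He _ (B i j s t sh th)).1.1; have := (He _ (B j i s' t' sh' th')).1.2.
have comm (u v : R) : x + u *: delta_mx 0 i + v *: delta_mx 0 j =
  x + v *: delta_mx 0 j + u *: delta_mx 0 i by rewrite addrAC.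
rewrite !comm in E1; rewrite (comm s t).
have hn0 : h != 0 by apply/eqP => hz; move: e0; rewrite hE hz mulr0 ltxx.
have -> : partial j (partial i f) (x + t *: delta_mx 0 j + s *: delta_mx 0 i) =
    partial i (partial j f) (x + s' *: delta_mx 0 j + t' *: delta_mx 0 i).
  have swap (a1 a2 a3 a4 : R) : a1 - a2 - (a3 - a4) = a1 - a3 - (a2 - a4) by ring.
  apply: (mulIf hn0); apply: (mulIf hn0).
  by rewrite /= -[LHS]E1 -[RHS]E2 [LHS]swap.
set v := partial i (partial j f) (_ + _) => Hb Ha.
have := le_lt_trans (ler_distD v a b)
  (ltrD Ha (eq_ind _ (fun r => is_true (r < eps)) Hb _ (distrC b v))).
by rewrite /eps -splitr ltxx.
Qed.

Lemma near_eq_partial (R : realType) (n : nat) (f g : 'rV[R]_n -> R)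
    (U : set 'rV[R]_n) (x : 'rV[R]_n) (j : 'I_n) :
  open U -> U x -> (forall y, U y -> f y = g y) ->
  partial j f x = partial j g x.
Proof.
move=> oU Ux fg; apply: near_eq_derive.
by apply: filterS (open_nbhs_nbhs (conj oU Ux)).
Qed.

Section OrthogonalJacobian.
Variables (R : realType) (n : nat) (U : set 'rV[R]_n) (F : 'rV[R]_n -> 'rV[R]_n).
Hypothesis oU : open U.
Hypothesis sF : forall j, smooth_on U (fun y => F y 0 j).
Hypothesis orthoF : forall y, U y -> diff_mx F y *m (diff_mx F y)^T = 1%:M.

Let Fk k := fun y => F y 0 k.

Let sFk k : smooth_on U (Fk k) := sF k.

(* The coefficients of the second derivatives of [F] in the frame of its first
   derivatives. *)
Let christoffel (l i j : 'I_n) (y : 'rV[R]_n) : R :=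
  \sum_k partial l (partial i (Fk k)) y * partial j (Fk k) y.

Let christoffel_sym l i j y : U y -> christoffel l i j y = christoffel i l j y.
Proof.
by move=> Uy; apply: eq_bigr => k _; rewrite (partialC _ _ oU (sFk k) Uy).
Qed.

(* Differentiate the constant inner product of two rows of the Jacobian. *)
Let christoffel_antisym l i j y : U y ->
  christoffel l i j y = - christoffel l j i y.
Proof.
move=> Uy; apply/eqP; rewrite -addr_eq0 -big_split /=; apply/eqP.
have d k m : derivable (partial m (Fk k)) y (delta_mx 0 l).
  by apply: smooth_on_derivable Uy; exact: smooth_on_partial.
have D0 : partial l (fun z => \sum_k partial i (Fk k) z * partial j (Fk k) z) y = 0.
  rewrite (near_eq_partial l (g := cst ((i == j)%:R)) oU Uy).
    by rewrite /partial derive_cst.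
  move=> z Uz; have := orthoF Uz => /matrixP/(_ i j); rewrite !mxE /cst => <-.
  by apply: eq_bigr => k _; rewrite !mxE.
rewrite -[RHS]D0 /partial; symmetry.
transitivity ('D_(delta_mx 0 l) (\sum_k (partial i (Fk k) \* partial j (Fk k))) y).
  by congr ('D__ _ _); apply/funext => z; rewrite fct_sumE.
rewrite derive_sum; last by move=> k; exact: derivableM.
apply: eq_bigr => k _; rewrite (deriveM (d k i) (d k j)) [RHS]addrC.
by congr (_ + _); exact: mulrC.
Qed.

(* A tensor symmetric in its first two indices and antisymmetric in its last two
   vanishes. *)
Let christoffel0 l i j y : U y -> christoffel l i j y = 0.
Proof.
move=> Uy; have A := christoffel_antisym; have S := christoffel_sym.
have := A l i j y Uy; rewrite (S l j i y Uy) (A j l i y Uy) (S j i l y Uy).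
by rewrite (A i j l y Uy) (S i l j y Uy); lra.
Qed.

(* The rows of the Jacobian are a basis. *)
Let second_partial0 l i k y : U y -> partial l (partial i (Fk k)) y = 0.
Proof.
move=> Uy; pose v : 'rV[R]_n := \row_k partial l (partial i (Fk k)) y.
have : v *m (diff_mx F y)^T = 0.
  apply/rowP => j; rewrite !mxE -[RHS](christoffel0 l i j Uy).
  by apply: eq_bigr => m _; rewrite !mxE.
move=> /(congr1 (mulmx^~ (diff_mx F y))); rewrite /= -mulmxA (mulmx1C (orthoF Uy)).
by rewrite mulmx1 mul0mx => /rowP/(_ k); rewrite !mxE.
Qed.

(** A local isometry of Euclidean space is affine: its second derivatives vanish,
    by the argument that makes the Levi-Civita connection unique. *)
Lemma orthogonal_jacobian_affine (x : 'rV[R]_n) : U x ->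
  exists (e : R) (A : 'M[R]_n) (b : 'rV[R]_n),
    [/\ 0 < e, ball x e `<=` U, A *m A^T = 1%:M &
      forall y, ball x e y -> F y = y *m A + b].
Proof.
move=> Ux; have nU : nbhs x U by exact: open_nbhs_nbhs.
have [e /= e0 He] := (nbhs_ballP _ _).1 nU.
have xe : ball x e x by exact: ballxx.
pose A := diff_mx F x.
exists e, A, (F x - x *m A); split => // [|y xy]; first exact: orthoF.
have dA i k (y' : 'rV[R]_n) : ball x e y' -> partial i (Fk k) y' = A i k.
  move=> By'; rewrite [RHS]mxE.
  apply: (box_partial0_cst (f := partial i (Fk k)) (box_ball e0) _ _ By' xe).
    move=> z m Bz; apply: (@smooth_on_derivable _ _ U); last exact: He.
    exact: smooth_on_partial.
  by move=> z m Bz; apply: second_partial0; exact: He.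
apply/rowP => k; pose L (z : 'rV[R]_n) := (z *m A) 0 k.
suff : Fk k y - L y = Fk k x - L x.
  by rewrite /Fk /L !mxE => E; lra.
have dL (z : 'rV[R]_n) (i : 'I_n) : is_derive z (delta_mx 0 i) L (A i k).
  have -> : A i k = L (delta_mx 0 i) by rewrite /L -rowE [RHS]mxE.
  have nearL : \forall h \near 0^',
      h^-1 *: ((L \o shift z) (h *: delta_mx 0 i) - L z) = L (delta_mx 0 i).
    near=> h; have hn0 : h != 0 by near: h; exact: nbhs_dnbhs_neq.
    have LD : L (h *: delta_mx 0 i + z) = h * L (delta_mx 0 i) + L z.
      by rewrite /L mulmxDl -scalemxAl [LHS]mxE; congr (_ + _); rewrite mxE.
    rewrite /= LD addrK.
    by rewrite [LHS]mulrA mulVf // mul1r.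
  apply: DeriveDef; first exact: is_cvg_near_cst nearL.
  by apply: lim_near_cst => //; exact: nearL.
have sL (z : 'rV[R]_n) (m : 'I_n) : ball x e z -> is_derive z (delta_mx 0 m) (Fk k - L) 0.
  move=> Bz; have Uz := He _ Bz.
  have dF : is_derive z (delta_mx 0 m) (Fk k) (A m k).
    by rewrite -(dA m k z Bz); apply: derivableP; exact: smooth_on_derivable (sFk k) Uz.
  by have := is_deriveB dF (dL z m); rewrite addrN.
apply: (box_partial0_cst (f := Fk k - L) (box_ball e0) _ _ xy xe).
  by move=> z m Bz; have [] := sL z m Bz.
by move=> z m Bz; have [] := sL z m Bz.
Unshelve. all: by end_near. Qed.
End OrthogonalJacobian.

(** * Isometries of flat tori *)

Section Lattice.
Variables (R : realType) (n : nat) (B : 'M[R]_n).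

Lemma latticeD x y : lattice B x -> lattice B y -> lattice B (x + y).
Proof. by move=> [z _ <-] [t _ <-]; exists (z + t) => //; rewrite map_mxD mulmxDl. Qed.

Lemma latticeN x : lattice B x -> lattice B (- x).
Proof. by move=> [z _ <-]; exists (- z) => //; rewrite map_mxN mulNmx. Qed.

Lemma latticeB x y : lattice B x -> lattice B y -> lattice B (x - y).
Proof. by move=> Bx By; apply: latticeD => //; exact: latticeN. Qed.

(** What the gluing of local lifts uses of the discreteness of a lattice. *)
Lemma lattice_segment0 (x : 'rV[R]_n) (d : R) : B \in unitmx -> 0 < d ->
  (forall t, 0 <= t <= d -> lattice B (t *: x)) -> x = 0.
Proof.
move=> uB d0 H; suff : x *m invmx B = 0.
  by move=> /(congr1 (mulmx^~ B)); rewrite /= mulmxKV // mul0mx.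
apply/rowP => j; rewrite [RHS]mxE; set r := _ 0 j; apply/eqP/negPn/negP => r0.
have I t : 0 <= t <= d -> exists c : int, t * r = c%:~R.
  move=> /H[z _ E]; exists (z 0 j).
  have /rowP/(_ j) : map_mx intr z = t *: (x *m invmx B).
    by rewrite scalemxAl -E mulmxK.
  by rewrite [LHS]mxE [RHS]mxE => ->.
(* A multiple of [r] of absolute value at most 1/2, which cannot be a nonzero
   integer. *)
pose t := Num.min d (2 * `|r|)^-1.
have t0 : 0 < t by rewrite lt_min d0 invr_gt0 mulr_gt0 ?normr_gt0.
have [|c cE] := I t; first by rewrite ltW //= ge_min lexx.
have : `|t * r| < 1.
  rewrite normrM (gtr0_norm t0) -ltr_pdivlMr ?normr_gt0 // div1r.
  apply: (@le_lt_trans _ _ (2 * `|r|)^-1); first by rewrite ge_min lexx orbT.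
  rewrite invfM -[ltRHS]mul1r ltr_pM2r ?invr_gt0 ?normr_gt0 //.
  by rewrite invf_lt1 // ltr1n.
rewrite cE -intr_norm -[1]/(1%:~R) ltr_int => c1.
have {c1} c0 : c = 0 by apply/eqP; move: c1; lia.
move: cE; rewrite c0 mulr0z => /eqP; rewrite mulf_eq0 (gt_eqF t0) /=.
by apply/negP.
Qed.

End Lattice.

Section IsometryLinear.
Variables (R : realType) (n : nat) (B1 B2 : 'M[R]_n).
Variables f g : 'rV[R]_n -> 'rV[R]_n.
Hypothesis uB2 : B2 \in unitmx.
Hypothesis fg : torus_isometry B1 B2 f g.

Let affine_near (A : 'M[R]_n) (b x : 'rV[R]_n) : Prop :=
  \forall y \near x, torus_eq B2 (f y) (y *m A + b).

Let locally_affine x : exists (A : 'M[R]_n) (b : 'rV[R]_n),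
  A *m A^T = 1%:M /\ affine_near A b x.
Proof.
case: fg => -[_ /(_ x)[U [F [Ux]]]] sl _ _ _ /(_ _ _ sl) dF.
case: (sl) => oU FE sF.
have [e [A [b [e0 eU AA bE]]]] := orthogonal_jacobian_affine oU sF dF Ux.
exists A, b; split => //; apply/nbhs_ballP; exists e => // y /= By.
rewrite -(bE _ By) /torus_eq -opprB; apply: latticeN; apply: FE; exact: eU.
Qed.

(* Two affine lifts of [f] over the same open set differ by an affine map with
   values in the lattice, which must be constant. *)
Let affine_near_unique A A' b b' x : affine_near A b x -> affine_near A' b' x ->
  A = A' /\ lattice B2 (b - b').
Proof.
move=> H H'; have [e /= e0 He] := (nbhs_ballP _ _).1 (filterI H H').
have D y : ball x e y -> lattice B2 (y *m (A - A') + (b - b')).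
  move=> /He[h h']; have := latticeB h' h.
  rewrite mulmxBr; congr (lattice B2 _); apply/rowP => j; rewrite !mxE; ring.
have xe : ball x e x by exact: ballxx.
have AA : A = A'.
  apply/eqP; rewrite -subr_eq0; apply/eqP/row_matrixP => i; rewrite row0 rowE.
  apply: (@lattice_segment0 _ _ B2 _ (e / 2)) => //; first by lra.
  move=> t te; have := latticeB (D (x + t *: delta_mx 0 i) _) (D x xe).
  rewrite mulmxDl -scalemxAl; have -> (u v w : 'rV[R]_n) : u + v + w - (u + w) = v.
    by apply/rowP => k; rewrite !mxE; ring.
  apply; apply/rV_ballP => // j; rewrite !mxE opprD addrA subrr sub0r normrN.
  rewrite normrM; case: (_ && _); rewrite ?normr0 ?mulr0 // normr1 mulr1.
  rewrite ger0_norm; lra.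
by split => //; have := D _ xe; rewrite AA subrr mulmx0 add0r.
Qed.

Let affine_near_open A b : open (affine_near A b).
Proof.
rewrite openE => x; rewrite /affine_near /interior => H.
by apply: nbhs_interior.
Qed.

(* The set where the affine lift found at 0 is a lift is open and closed on each
   line through 0. *)
Let affine_everywhere A b x : affine_near A b 0 -> affine_near A b x.
Proof.
move=> H0.
have oC : open (~` affine_near A b).
  rewrite openE => y nH; have [A' [b' [_ H']]] := locally_affine y.
  have : nbhs y (affine_near A' b').
    by apply: open_nbhs_nbhs; split => //; exact: affine_near_open.
  apply: filterS => z Hz' Hz; apply: nH.
  have [-> bb] := affine_near_unique Hz Hz'.
  apply: filterS H' => u Hu; rewrite /torus_eq.
  have := latticeB Hu bb; rewrite /torus_eq; congr (lattice B2 _).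
  by apply/rowP => j; rewrite !mxE; ring.
pose T := [set t : R | affine_near A b (t *: x)].
have TT : T = setT.
  have cl : continuous (fun t : R => t *: x) by exact: scalel_continuous.
  have : connected (@setT R) by apply/connected_intervalP.
  move=> /(_ T); apply.
  - by exists 0; rewrite /T /= scale0r.
  - exists T; last by rewrite setTI.
    by move/continuousP : cl; apply; exact: affine_near_open.
  - exists T; last by rewrite setTI.
    rewrite -openC; have := (continuousP _).1 cl _ oC; exact.
have T1 : T 1 by rewrite TT.
by move: T1; rewrite /T /= scale1r.
Qed.

(** Rigidity of flat tori: an isometry lifts to one Euclidean motion, whose
    linear part carries the first lattice into the second. *)
Lemma torus_isometry_linear : exists A : 'M[R]_n,
  A *m A^T = 1%:M /\ forall x, lattice B1 x -> lattice B2 (x *m A).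
Proof.
have [A [b [AA H0]]] := locally_affine 0.
exists A; split => // x Lx.
have H y : torus_eq B2 (f y) (y *m A + b).
  exact: nbhs_singleton (affine_everywhere y H0).
have fx : torus_eq B2 (f x) (f 0).
  by case: fg => -[fE _] _ _ _ _; apply: fE; rewrite /torus_eq subr0.
have := latticeB (latticeD fx (H 0)) (H x).
rewrite /torus_eq mul0mx add0r; congr (lattice B2 _).
by apply/rowP => j; rewrite !mxE; ring.
Qed.

End IsometryLinear.

(** * Integrals of Lipschitz functions over a period *)

Section LineIntegral.
Variable R : realType.
Implicit Types G : R -> R.

Definition lipschitz1 (K : R) G := forall s t, `|G s - G t| <= K * `|s - t|.

Lemma lipschitz1_continuous K G : lipschitz1 K G -> continuous G.
Proof.
move=> GK x; apply/cvgrPdist_le => /= e e0; near=> t.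
apply: le_trans (GK x t) _.
have K1 : 0 < `|K| + 1 by rewrite ltr_pwDr.
apply: (@le_trans _ _ ((`|K| + 1) * `|x - t|)).
  by apply: ler_wpM2r => //; rewrite (le_trans (ler_norm K)) // lerDl.
rewrite mulrC -ler_pdivlMr //; near: t; apply: cvgr_dist_le => //.
by rewrite divr_gt0.
Unshelve. all: by end_near. Qed.

Lemma lipschitz1_integrable K G (a b : R) : lipschitz1 K G ->
  (@lebesgue_measure R).-integrable `[a, b] (EFin \o G).
Proof.
move=> GK; apply: continuous_compact_integrable; first exact: segment_compact.
by apply: continuous_subspaceT; exact: lipschitz1_continuous GK.
Qed.

Lemma lipschitz1_translate K G s : lipschitz1 K G -> lipschitz1 K (fun t => G (t + s)).
Proof. by move=> GK x y; apply: le_trans (GK _ _) _; rewrite opprD addrACA subrr addr0. Qed.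

(** The bounds leave room around every interval of integration, so that [P] is
    differentiable at the endpoints too. *)
Lemma lipschitz1_primitive K G (u : R) : lipschitz1 K G -> exists P : R -> R,
  (forall x, -1 < x < u -> is_derive x 1 P (G x)) /\
  forall s, 0 <= s -> s + 1 < u ->
    \int[@lebesgue_measure R]_(t in `[0, 1]) G (t + s) = P (1 + s) - P s.
Proof.
move=> GK; have cG := lipschitz1_continuous GK.
pose P x := \int[@lebesgue_measure R]_(t in `[-1, x]) G t.
have dP x : -1 < x < u -> is_derive x 1 P (G x).
  move=> /andP[ax xu].
  have [d E] := continuous_FTC1_closed xu (lipschitz1_integrable (-1) u GK) ax (cG x).
  by split; [exact: d|rewrite -derive1E; exact: E].
exists P; split => // s s0 su.
have dPs x : -1 < x < u - s -> is_derive x 1 (fun t => P (t + s)) (G (x + s)).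
  move=> xs; have := dP (x + s); move=> /(_ _)[]; first by lra.
  move=> d E.
  have EQ : (fun h : R => h^-1 *: (((fun t => P (t + s)) \o shift x) (h *: 1) - P (x + s))) =
     (fun h : R => h^-1 *: ((P \o shift (x + s)) (h *: 1) - P (x + s))).
    by apply/funext => h /=; rewrite addrA.
  by split; rewrite /derivable /derive EQ.
have cPs x : -1 < x < u - s -> {for x, continuous (fun t => P (t + s))}.
  move=> /dPs[d _]; apply: differentiable_continuous.
  exact/derivable1_diffP.
rewrite /Rintegral (@continuous_FTC2 _ (fun t => G (t + s)) (fun t => P (t + s)) 0 1).
- by rewrite add0r.
- exact: ltr01.
- by apply: continuous_subspaceT; apply: lipschitz1_continuous (lipschitz1_translate s GK).
- split.
  + by move=> x; rewrite in_itv /= => x01; have [|//] := dPs x; lra.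
  + by apply: cvg_at_right_filter; apply: cPs; lra.
  + by apply: cvg_at_left_filter; apply: cPs; lra.
- by move=> x; rewrite in_itv /= derive1E => x01; have [|//] := dPs x; lra.
Qed.

(** As a function of [w], the integral over a period has derivative
    [G (1 + w) - G w = 0]. *)
Lemma lipschitz1_integral_translate K G (w : R) : lipschitz1 K G ->
  (forall t (z : int), G (t + z%:~R) = G t) ->
  \int[@lebesgue_measure R]_(t in `[0, 1]) G (t + w) =
  \int[@lebesgue_measure R]_(t in `[0, 1]) G t.
Proof.
move=> GK Gper; wlog w0 : w / 0 <= w.
  move=> H; pose N : int := Num.bound `|w|.
  have wN : 0 <= w + N%:~R.
    have lN : `|w| < N%:~R := archi_boundP (normr_ge0 w).
    by have := ler_norm (- w); rewrite normrN; lra.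
  rewrite -(H _ wN); apply: eq_Rintegral => t _.
  by rewrite addrA Gper.
have [P [dP IP]] := lipschitz1_primitive (w + 2) GK.
have -> : \int[@lebesgue_measure R]_(t in `[0, 1]) G t = P (1 + 0) - P 0.
  by rewrite -IP //; [apply: eq_Rintegral => t _; rewrite addr0|lra].
rewrite IP //; last by lra.

have dD x : 0 <= x <= w -> is_derive x 1 (fun s => P (s + 1) - P s) 0.
  move=> xw; rewrite -[0](subrr (G x)) -{1}(Gper x 1).
  have dP1 : is_derive x 1 (fun s => P (s + 1)) (G (x + 1)).
    have [|d <-] := dP (x + 1); first by lra.
    have E : (fun h : R => h^-1 *: (((fun s => P (s + 1)) \o shift x) (h *: 1) - P (x + 1))) =
      (fun h : R => h^-1 *: ((P \o shift (x + 1)) (h *: 1) - P (x + 1))).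
      by apply/funext => h /=; rewrite addrA.
    by split; rewrite /derivable /derive E.
  by apply: is_deriveB; apply: dP; lra.
have [x||c cw] := @MVT_segment R (fun s => P (s + 1) - P s) (fun=> 0) 0 w w0.
- by rewrite in_itv /= => x0w; apply: dD; lra.
- apply: derivable_within_continuous => x; rewrite in_itv /= => x0w.
  by have [] := dD x x0w.
- by rewrite mul0r add0r [w + 1]addrC addr0 => /eqP; rewrite subr_eq0 => /eqP.
Qed.

(** Otherwise the Lipschitz bound keeps [G] positive on an interval [[0, h]],
    where its primitive would increase. *)
Lemma lipschitz1_integral0 K G : lipschitz1 K G -> (forall t, 0 <= G t) ->
  \int[@lebesgue_measure R]_(t in `[0, 1]) G t = 0 -> G 0 = 0.
Proof.
move=> GK G0 I0; have [P [dP IP]] := lipschitz1_primitive 2 GK.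
have P01 : P 1 - P 0 = 0.
  rewrite -[RHS]I0 -{1}[1]addr0 -IP ?lexx //; last by lra.
  by apply: eq_Rintegral => t _; rewrite addr0.
have step a b : 0 <= a -> a <= b -> b <= 1 -> exists2 c, a <= c <= b &
    P b - P a = G c * (b - a).
  move=> a0 ab b1; have [x||c] := @MVT_segment R P G a b ab.
  - by rewrite in_itv /= => xab; apply: dP; lra.
  - apply: derivable_within_continuous => x; rewrite in_itv /= => xab.
    by have [|] := dP x; first lra.
  - by rewrite in_itv; exists c.
apply/eqP; rewrite eq_le G0 andbT leNgt; apply/negP => Gpos.
pose h := Num.min 1 (G 0 / (2 * (`|K| + 1))).
have K1 : 0 < `|K| + 1 by rewrite ltr_pwDr.
have h0 : 0 < h by rewrite lt_min ltr01 divr_gt0 // mulr_gt0.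
have h1 : h <= 1 by rewrite ge_min lexx.
have [c ch Ec] := step 0 h (lexx _) (ltW h0) h1.
have [d dh Ed] := step h 1 (ltW h0) h1 (lexx _).
have Gc : G c = 0.
  have := mulr_ge0 (G0 d) (_ : 0 <= 1 - h); rewrite -Ed subr_ge0 => /(_ h1) H.
  have := mulr_ge0 (G0 c) (ltW h0); rewrite -[h]subr0 -Ec => H'.
  have : G c * (h - 0) = 0 by rewrite -Ec; lra.
  by move=> /eqP; rewrite subr0 mulf_eq0 (gt_eqF h0) orbF => /eqP.
have := GK 0 c; rewrite Gc subr0 sub0r normrN gtr0_norm // ger0_norm; last by lra.
have KK := ler_norm K.
have cK : K * c <= (`|K| + 1) * h by nra.
have : (`|K| + 1) * h <= G 0 / 2.
  rewrite -ler_pdivlMl //; apply: le_trans (_ : G 0 / (2 * (`|K| + 1)) <= _).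
    by rewrite ge_min lexx orbT.
  by rewrite invfM mulrA mulrC.
lra.
Qed.

End LineIntegral.

(** * Iterated integrals over the unit cube *)

Section CubeIntegral.
Variable R : realType.

(** The class of integrands for iterated integrals: it is stable under integration
    in some of the variables, with the same constant. *)
Definition lipschitzK n (K : R) (f : 'rV[R]_n -> R) :=
  forall x y, `|f x - f y| <= K * \sum_j `|x 0 j - y 0 j|.

Definition slice m (f : 'rV[R]_(1 + m) -> R) (t : R) : 'rV[R]_m -> R :=
  fun v => f (row_mx (t%:M : 'rV[R]_1) v).

Lemma cube_integralS m (f : 'rV[R]_(1 + m) -> R) :
  cube_integral f =
  \int[@lebesgue_measure R]_(t in `[0, 1]) cube_integral (slice f t).
Proof. by []. Qed.

Lemma slice_dist m K (f : 'rV[R]_(1 + m) -> R) t s v w : lipschitzK K f ->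
  `|slice f t v - slice f s w| <= K * (`|t - s| + \sum_j `|v 0 j - w 0 j|).
Proof.
move=> fK; apply: le_trans (fK _ _) _; rewrite big_split_ord big_ord1 /=.
rewrite !row_mxEl !mxE eqxx mulr1n.
by under eq_bigr do rewrite !row_mxEr.
Qed.

Lemma slice_lipschitz m K (f : 'rV[R]_(1 + m) -> R) t :
  lipschitzK K f -> lipschitzK K (slice f t).
Proof. by move=> fK v w; have := slice_dist t t v w fK; rewrite subrr normr0 add0r. Qed.

Lemma cube_integral_cst n (c : R) : cube_integral (fun _ : 'rV[R]_n => c) = c.
Proof.
elim: n => [|m IH] //; rewrite (cube_integralS (m := m)).
under eq_Rintegral do rewrite /slice IH.
by rewrite Rintegral_cst //= lebesgue_measure_itv /= lte_fin ltr01 EFinN sube0 mulr1.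
Qed.

Lemma eq_cube_integral n (f g : 'rV[R]_n -> R) : f =1 g ->
  cube_integral f = cube_integral g.
Proof. by move=> /funext ->. Qed.

Lemma lipschitzK_lin n K L a (f g : 'rV[R]_n -> R) :
  lipschitzK K f -> lipschitzK L g ->
  lipschitzK (`|a| * K + L) (fun x => a * f x + g x).
Proof.
move=> fK gL x y; rewrite opprD addrACA -mulrBr mulrDl -mulrA.
apply: le_trans (ler_normD _ _) _; apply: lerD; last exact: gL.
by rewrite normrM ler_wpM2l.
Qed.

Lemma lipschitzK_cst n (c : R) : lipschitzK 0 (fun _ : 'rV[R]_n => c).
Proof. by move=> x y; rewrite subrr normr0 mul0r. Qed.

(* Linearity and monotonicity are proved together, because together they make the
   inner integral a Lipschitz, hence integrable, function of the outer variable. *)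
Let cube_integral_props n :
  (forall K L a f g, @lipschitzK n K f -> lipschitzK L g ->
     cube_integral (fun x => a * f x + g x) = a * cube_integral f + cube_integral g) /\
  (forall K L f g, @lipschitzK n K f -> lipschitzK L g -> (forall x, f x <= g x) ->
     cube_integral f <= cube_integral g).
Proof.
elim: n => [|m [IHl IHm]]; first by split=> // K L f g _ _ ->.
have contr K f : @lipschitzK (1 + m) K f ->
    lipschitz1 K (fun t => cube_integral (slice f t)).
  move=> fK.
  have half t s : cube_integral (slice f t) - cube_integral (slice f s) <= K * `|t - s|.
    rewrite lerBlDr; pose c := K * `|t - s|.
    have cstL := @lipschitzK_cst m c.
    have -> : K * `|t - s| + cube_integral (slice f s) =
        cube_integral (fun x => 1 * c + slice f s x).
      by rewrite (IHl _ _ _ _ _ cstL (slice_lipschitz s fK)) mul1r cube_integral_cst.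
    apply: IHm (slice_lipschitz t fK) (lipschitzK_lin 1 cstL (slice_lipschitz s fK)) _.
    move=> x; rewrite mul1r -lerBlDr.
    apply: le_trans (ler_norm _) _; apply: le_trans (slice_dist _ _ _ _ fK) _.
    by rewrite big1 ?addr0 // => j _; rewrite subrr normr0.
  by move=> t s; rewrite ler_norml; have := half t s; have := half s t;
    rewrite distrC; lra.
split=> [K L a f g fK gL|K L f g fK gL fg].
- rewrite !(cube_integralS (m := m)).
  have If := lipschitz1_integrable 0 1 (contr _ _ fK).
  have Ig := lipschitz1_integrable 0 1 (contr _ _ gL).
  rewrite -RintegralZl // -RintegralD //; last first.
    by have := @integrableZl _ _ _ (@lebesgue_measure R) _ _ a _ If; apply.
  apply: eq_Rintegral => t _.
  by rewrite -(IHl K L a _ _ (slice_lipschitz t fK) (slice_lipschitz t gL)).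
- rewrite !(cube_integralS (m := m)); apply: le_Rintegral => //.
  + exact: lipschitz1_integrable (contr _ _ fK).
  + exact: lipschitz1_integrable (contr _ _ gL).
  + move=> t _; apply: IHm (slice_lipschitz t fK) (slice_lipschitz t gL) _.
    by move=> x; exact: fg.
Qed.

Lemma cube_integral_lin n K L a (f g : 'rV[R]_n -> R) :
  lipschitzK K f -> lipschitzK L g ->
  cube_integral (fun x => a * f x + g x) = a * cube_integral f + cube_integral g.
Proof. exact: (cube_integral_props n).1. Qed.

Lemma le_cube_integral n K L (f g : 'rV[R]_n -> R) :
  lipschitzK K f -> lipschitzK L g -> (forall x, f x <= g x) ->
  cube_integral f <= cube_integral g.
Proof. exact: (cube_integral_props n).2. Qed.

Lemma cube_integral_dist n K L c (f g : 'rV[R]_n -> R) :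
  lipschitzK K f -> lipschitzK L g -> (forall x, `|f x - g x| <= c) ->
  `|cube_integral f - cube_integral g| <= c.
Proof.
move=> fK gL fg.
have half K' L' (f' g' : 'rV[R]_n -> R) : lipschitzK K' f' -> lipschitzK L' g' ->
   (forall x, `|f' x - g' x| <= c) -> cube_integral f' - cube_integral g' <= c.
  move=> fK' gL' fg'.
  have cstL := @lipschitzK_cst n c.
  have -> : (cube_integral f' - cube_integral g' <= c) =
      (cube_integral f' <= cube_integral (fun x => 1 * c + g' x)).
    by rewrite (cube_integral_lin _ cstL gL') mul1r cube_integral_cst lerBlDr.
  apply: le_cube_integral fK' (lipschitzK_lin _ cstL gL') _ => x.
  by rewrite mul1r -lerBlDr (le_trans (ler_norm _)).
rewrite ler_norml; have := half _ _ _ _ fK gL fg.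
have gf x : `|g x - f x| <= c by rewrite distrC.
by have := half _ _ _ _ gL fK gf; lra.
Qed.

Lemma slice_integral_lipschitz1 m K (f : 'rV[R]_(1 + m) -> R) :
  lipschitzK K f -> lipschitz1 K (fun t => cube_integral (slice f t)).
Proof.
move=> fK t s; apply: cube_integral_dist (slice_lipschitz t fK) (slice_lipschitz s fK) _.
move=> x; apply: le_trans (slice_dist _ _ _ _ fK) _.
by rewrite big1 ?addr0 // => j _; rewrite subrr normr0.
Qed.

Lemma cube_integral_translate n K (f : 'rV[R]_n -> R) (w : 'rV[R]_n) :
  lipschitzK K f ->
  (forall x (z : 'rV[int]_n), f (x + map_mx intr z) = f x) ->
  cube_integral (fun x => f (x + w)) = cube_integral f.
Proof.
elim: n f w => [|m IH] f w fK per; first by rewrite /= [0 + w]thinmx0.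
rewrite !(cube_integralS (m := m)).
pose w' : 'rV[R]_(1 + m) := w.
pose w0 : R := (lsubmx w') 0 0; pose w1 : 'rV[R]_m := rsubmx w'.
have wE : w' = row_mx (w0%:M : 'rV[R]_1) w1 by rewrite -mx11_scalar hsubmxK.
have addE t (v : 'rV[R]_m) s u : row_mx (t%:M : 'rV[R]_1) v + row_mx (s%:M : 'rV[R]_1) u =
    row_mx ((t + s)%:M : 'rV[R]_1) (v + u) :> 'rV[R]_(1 + m).
  by rewrite add_row_mx -raddfD.
have mapE (s : int) (u : 'rV[int]_m) :
    map_mx intr (row_mx (s%:M : 'rV[int]_1) u : 'rV[int]_(1 + m)) =
    row_mx ((s%:~R : R)%:M : 'rV[R]_1) (map_mx intr u).
  by rewrite map_row_mx map_scalar_mx.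
pose G t := cube_integral (slice f t).
rewrite -(@lipschitz1_integral_translate _ K G w0).
- apply: eq_Rintegral => t _; rewrite /G.
  rewrite -(IH (slice f (t + w0)) w1 (slice_lipschitz _ fK)).
    apply: eq_cube_integral => v; rewrite /slice -addE -wE //.
  move=> v z; rewrite /slice.
  rewrite -[RHS](per _ (row_mx 0%:M z : 'rV[int]_(1 + m))) mapE; congr f.
  by rewrite [RHS]addE addr0.
- exact: slice_integral_lipschitz1.
- move=> t z; apply: eq_cube_integral => v; rewrite /slice.
  rewrite -[RHS](per _ (row_mx z%:M 0 : 'rV[int]_(1 + m))) mapE; congr f.
  by rewrite [RHS]addE map_mx0 addr0.
Qed.

(** The conclusion is about the corner 0 only; translation invariance carries it
    to every point of a torus. *)
Lemma cube_integral_eq0 n K (f : 'rV[R]_n -> R) : lipschitzK K f ->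
  (forall x, 0 <= f x) -> cube_integral f = 0 -> f 0 = 0.
Proof.
elim: n f => [|m IH] f fK f0 // If.
have := IH (slice f 0) (slice_lipschitz _ fK) (fun v => f0 _).
rewrite {2}/slice raddf0 row_mx0; apply.
apply: (lipschitz1_integral0 (slice_integral_lipschitz1 fK)) If => t.
rewrite -(cube_integral_cst m 0).
by apply: le_cube_integral (@lipschitzK_cst m 0) (slice_lipschitz t fK) _ => v; exact: f0.
Qed.

End CubeIntegral.

(** * Smooth periodic functions *)

Section SmoothAlgebra.
Variables (R : realType) (n : nat).
Implicit Types f g : 'rV[R]_n -> R.

Notation smooth := (@smooth_on R n setT).

Lemma smooth_derivable f x j : smooth f -> derivable f x (delta_mx 0 j).
Proof. by move=> sf; apply: smooth_on_derivable sf _. Qed.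

Lemma smooth_continuous f : smooth f -> continuous f.
Proof. by move=> sf x; apply: smooth_on_continuous sf _. Qed.

Lemma smooth_partial f j : smooth f -> smooth (partial j f).
Proof. exact: smooth_on_partial. Qed.

(** Coinduction: smoothness is the largest property with this closure. *)
Lemma smooth_coind (P : ('rV[R]_n -> R) -> Prop) :
  (forall f, P f -> [/\ continuous f, forall x j, derivable f x (delta_mx 0 j) &
     forall j, P (partial j f)]) ->
  forall f, P f -> smooth f.
Proof.
move=> H f Pf s x _; have : P (foldr (@partial R n) f s).
  by elim: s => [|j s IH] //=; have [_ _] := H _ IH; apply.
by move=> /H[cf df _]; split; [exact: cf|move=> j; exact: df].
Qed.

Lemma partialD f g j : smooth f -> smooth g ->
  partial j (f \+ g) = partial j f \+ partial j g.
Proof.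
move=> sf sg; apply/funext => x; rewrite /partial deriveD //; exact: smooth_derivable.
Qed.

Lemma partialZ f c j : smooth f -> partial j (fun x => c * f x) = fun x => c * partial j f x.
Proof. by move=> sf; apply/funext => x; rewrite /partial deriveZ //; exact: smooth_derivable. Qed.

Lemma partialM f g j : smooth f -> smooth g ->
  partial j (f \* g) = (partial j f \* g) \+ (f \* partial j g).
Proof.
move=> sf sg; apply/funext => x; rewrite /partial deriveM; try exact: smooth_derivable.
by rewrite addrC /=; congr (_ + _); exact: mulrC.
Qed.

Lemma smooth_cst c : smooth (fun=> c).
Proof.
apply: (@smooth_coind (fun h => exists c, h = fun=> c)); last by exists c.
move=> _ [{}c ->]; split=> [|x j|j]; first by move=> x; exact: cst_continuous.
  exact: derivable_cst.
by exists 0; apply/funext => x; exact: derive_cst.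
Qed.

(** Coinduction needs a class stable under [partial]. By the Leibniz rule sums of
    products of smooth functions form one, whereas products alone do not. *)
Inductive smooth_generated : ('rV[R]_n -> R) -> Prop :=
| smooth_generated_base f : smooth f -> smooth_generated f
| smooth_generatedD f g : smooth_generated f -> smooth_generated g ->
    smooth_generated (f \+ g)
| smooth_generatedM f g : smooth_generated f -> smooth_generated g ->
    smooth_generated (f \* g).

Lemma smooth_generated_smooth f : smooth_generated f -> smooth f.
Proof.
apply: smooth_coind => {}f; elim=> {f}[f sf|f g sf [cf df pf] sg [cg dg pg]|
    f g sf [cf df pf] sg [cg dg pg]].
- split=> [|x j|j]; [exact: smooth_continuous|exact: smooth_derivable|].
  by apply: smooth_generated_base; exact: smooth_partial.
- split=> [|x j|j]; [by move=> x; apply: continuousD; [exact: cf|exact: cg]|exact: derivableD|].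
  have -> : partial j (f \+ g) = partial j f \+ partial j g.
    by apply/funext => x; rewrite /partial deriveD.
  exact: smooth_generatedD.
- split=> [|x j|j]; [by move=> x; apply: continuousM; [exact: cf|exact: cg]|exact: derivableM|].
  have -> : partial j (f \* g) = (partial j f \* g) \+ (f \* partial j g).
    apply/funext => x; rewrite /partial deriveM //.
    by rewrite addrC /=; congr (_ + _); exact: mulrC.
  by apply: smooth_generatedD; exact: smooth_generatedM.
Qed.

Lemma smoothD f g : smooth f -> smooth g -> smooth (f \+ g).
Proof.
by move=> sf sg; apply/smooth_generated_smooth/smooth_generatedD;
  exact: smooth_generated_base.
Qed.

Lemma smoothM f g : smooth f -> smooth g -> smooth (f \* g).
Proof.
by move=> sf sg; apply/smooth_generated_smooth/smooth_generatedM;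
  exact: smooth_generated_base.
Qed.

Lemma smoothZ f c : smooth f -> smooth (fun x => c * f x).
Proof. by move=> sf; exact: smoothM (smooth_cst c) sf. Qed.

Lemma partial_translate f v j :
  partial j (fun x => f (x + v)) = fun x => partial j f (x + v).
Proof. by apply/funext => x; exact: derive_translate. Qed.

Lemma smooth_translate f v : smooth f -> smooth (fun x => f (x + v)).
Proof.
move=> sf.
apply: (@smooth_coind (fun h => exists2 f, smooth f & h = fun x => f (x + v))); last first.
  by exists f.
move=> _ [{}f {}sf ->]; split=> [|x j|j].
- move=> x; have cs : {for x, continuous (fun y : 'rV[R]_n => y + v)}.
    by apply: continuousD => //; exact: cst_continuous.
  by apply: (continuous_comp cs); exact: smooth_continuous.
- by rewrite derivable_translate; exact: smooth_derivable.
- by exists (partial j f); [exact: smooth_partial|rewrite partial_translate].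
Qed.

End SmoothAlgebra.

Section TorusFunctions.
Variables (R : realType) (n : nat) (B : 'M[R]_n).
Hypothesis uB : B \in unitmx.
Implicit Types f g : 'rV[R]_n -> R.

Notation smooth := (@smooth_on R n setT).
Notation CI := (@cube_integral R n).

Definition torus_fun f :=
  smooth f /\ forall x y, torus_eq B x y -> f x = f y.

Lemma torus_eq_lattice x v : lattice B v -> torus_eq B (x + v) x.
Proof. by rewrite /torus_eq addrAC subrr add0r. Qed.

Lemma torus_eqD x y v : torus_eq B (x + v) (y + v) = torus_eq B x y.
Proof. by rewrite /torus_eq opprD addrACA subrr addr0. Qed.

Lemma torus_fun_partial f j : torus_fun f -> torus_fun (partial j f).
Proof.
move=> [sf pf]; split; first exact: smooth_partial.
move=> x y xy; rewrite /partial.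
have E : (fun z => f (z + (x - y))) = f.
  by apply/funext => z; apply/pf; exact: torus_eq_lattice.
have := derive_translate f y (delta_mx 0 j) (x - y).
by rewrite E => ->; rewrite addrC subrK.
Qed.

Lemma torus_fun_bounded f : torus_fun f -> exists K, 0 <= K /\ forall x, `|f x| <= K.
Proof.
move=> [sf pf].
(* Every point is equivalent to one of the fundamental parallelotope, which lies
   in this cube. *)
pose C := \sum_i \sum_j `|B i j|.
have C0 : 0 <= C by apply: sumr_ge0 => i _; apply: sumr_ge0.
pose A := [set v : 'rV[R]_n | forall i, `[- C, C]%classic (v 0 i)].
have cA : compact A.
  by apply: (@rV_compact R n (fun=> `[- C, C]%classic)) => i; exact: segment_compact.
have A0 : A !=set0 by exists 0 => i /=; rewrite mxE in_itv /= C0 oppr_le0 C0.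
have [|c cA' H] := EVT_max_rV A0 cA (f := fun v => `|f v|).
  apply: continuous_subspaceT => v.
  by apply: continuous_comp; [exact: smooth_continuous|exact: norm_continuous].
exists `|f c|; split => [|x]; first exact: normr_ge0.
pose t := x *m invmx B.
pose z : 'rV[int]_n := \row_j Num.floor (t 0 j).
have -> : f x = f ((t - map_mx intr z) *m B).
  apply: pf; rewrite mulmxBl mulmxKV // /torus_eq opprB addrC subrK.
  by exists z.
clearbody t.
apply: (H ((t - map_mx intr z) *m B)); apply/mem_set => j.
rewrite /= in_itv /= -ler_norml mxE.
apply: le_trans (ler_norm_sum _ _ _) _; apply: ler_sum => i _.
rewrite normrM; apply: (@le_trans _ _ `|B i j|); last first.
  by rewrite (bigD1 j) //= lerDl; apply: sumr_ge0.
apply: ler_piMl => //; rewrite !mxE.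
have /andP[l u] := floor_itv (t 0 i).
by rewrite ger0_norm ?subr_ge0 // lerBlDl -intrD1 ltW.
Qed.

(** The partial derivatives are periodic, hence bounded. *)
Lemma torus_fun_cube f : torus_fun f -> exists K, lipschitzK K (fun t => f (t *m B)).
Proof.
move=> tf; have [sf pf] := tf.
have [K [K0 HK]] : exists K, 0 <= K /\ forall j x, `|partial j f x| <= K.
  have H j := torus_fun_bounded (torus_fun_partial j tf).
  pose k j := projT1 (cid (H j)).
  have kP j : 0 <= k j /\ forall x, `|partial j f x| <= k j := projT2 (cid (H j)).
  exists (\sum_j k j); split=> [|j x]; first by apply: sumr_ge0 => j _; have [] := kP j.
  apply: le_trans ((kP j).2 x) _; rewrite (bigD1 j) //= lerDl.
  by apply: sumr_ge0 => i _; have [] := kP i.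
pose C := \sum_i \sum_j `|B i j|.
exists (K * C) => t s.
have HK' (x : 'rV[R]_n) j : setT x -> `|partial j f x| <= K by [].
apply: le_trans (box_lipschitz (@boxT R n) _ HK' (x := t *m B) (y := s *m B) I I) _.
  by move=> x j _; exact: smooth_derivable.
rewrite -mulrA ler_wpM2l // mulr_sumr.
have D j : (t *m B) 0 j - (s *m B) 0 j = \sum_i (t 0 i - s 0 i) * B i j.
  by rewrite !mxE -sumrB; apply: eq_bigr => i _; rewrite mulrBl.
under eq_bigr do rewrite D.
apply: (@le_trans _ _ (\sum_j \sum_i `|t 0 i - s 0 i| * `|B i j|)).
  apply: ler_sum => j _; apply: le_trans (ler_norm_sum _ _ _) _.
  by apply: ler_sum => i _; rewrite normrM.
rewrite exchange_big /=; apply: ler_sum => i _; rewrite -mulr_sumr mulrC.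
apply: ler_wpM2r => //; rewrite /C [leRHS](bigD1 i) //= lerDl.
by apply: sumr_ge0 => k _; apply: sumr_ge0.
Qed.

Lemma torus_integralD f g : torus_fun f -> torus_fun g ->
  torus_integral B (f \+ g) = torus_integral B f + torus_integral B g.
Proof.
move=> /torus_fun_cube[K fK] /torus_fun_cube[L gL]; rewrite /torus_integral -mulrDr.
congr (_ * _); rewrite -[cube_integral (fun t => f _)]mul1r -(cube_integral_lin 1 fK gL).
by apply: eq_cube_integral => t /=; rewrite mul1r.
Qed.

Lemma torus_integral0 : torus_integral B (fun=> 0) = 0.
Proof. by rewrite /torus_integral cube_integral_cst mulr0. Qed.

Lemma torus_integral_translate f v : torus_fun f ->
  torus_integral B (fun x => f (x + v)) = torus_integral B f.
Proof.
move=> tf; have [K fK] := torus_fun_cube tf; rewrite /torus_integral; congr (_ * _).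
rewrite -(cube_integral_translate (v *m invmx B) fK).
  by apply: eq_cube_integral => t; rewrite mulmxDl mulmxKV.
move=> x z; rewrite mulmxDl; apply: tf.2; apply: torus_eq_lattice.
by exists z.
Qed.

(** Integration by parts on the torus. By translation invariance the difference
    quotients of [f] have integral 0, and since the second derivative is bounded
    they are within [M * h] of [partial j f]. *)
Lemma torus_integral_partial f j : torus_fun f -> torus_integral B (partial j f) = 0.
Proof.
move=> tf; have tdf := torus_fun_partial j tf; have td2f := torus_fun_partial j tdf.
have [M [M0 HM]] := torus_fun_bounded td2f.
have [K fK] := torus_fun_cube tf; have [L dfL] := torus_fun_cube tdf.
pose e : 'rV[R]_n := delta_mx 0 j.
rewrite /torus_integral; suff -> : cube_integral (fun t => partial j f (t *m B)) = 0.
  by rewrite mulr0.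
set J := cube_integral _.
have small h : 0 < h -> `|J| <= M * h.
  move=> h0; rewrite -(ler_pM2l h0) -{1}(gtr0_norm h0) -normrM.
  have -> : h * J = h * J + cube_integral (fun t => f (t *m B)) -
     cube_integral (fun t => f ((t + h *: e *m invmx B) *m B)).
    rewrite (cube_integral_translate _ fK) ?addrK // => x z.
    by rewrite mulmxDl; apply: tf.2; apply: torus_eq_lattice; exists z.
  rewrite -(cube_integral_lin h dfL fK).
  apply: (cube_integral_dist (lipschitzK_lin h dfL fK) (L := K)).
    move=> x y; apply: le_trans (fK _ _) _; rewrite le_eqVlt; apply/orP; left; apply/eqP.
    by congr (_ * _); apply: eq_bigr => i _; rewrite !mxE; congr `|_|; ring.
  move=> t; rewrite mulmxDl mulmxKV //; set x := t *m B.
  have [s _|c ch E] := @MVT_coord R n f x e 0 h (ltW h0).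
    exact: smooth_derivable tf.1.
  rewrite scale0r addr0 subr0 in E.
  have -> : h * partial j f x + f x - f (x + h *: e) =
     h * (partial j f x - 'D_e f (x + c *: e)).
    have -> : f (x + h *: e) = f x + 'D_e f (x + c *: e) * h by rewrite -E [RHS]addrC subrK.
    move: (f x) (partial j f x) ('D_e f _) => u1 u2 u3; ring.
  rewrite normrM gtr0_norm // ler_pM2l // distrC.
  have /andP[c0 ch'] := ch.
  have [s _|d dc E'] := @MVT_coord R n (partial j f) x e 0 c c0.
    exact: smooth_derivable tdf.1.
  rewrite scale0r addr0 subr0 in E'.
  by rewrite E' normrM (ger0_norm c0); apply: ler_pM => //; exact: HM.
apply/eqP; rewrite -normr_eq0; apply/eqP/le_anti; rewrite normr_ge0 andbT.
apply/ler_addgt0Pr => eps eps0; rewrite add0r.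
have M1 : 0 < M + 1 by rewrite ltr_pwDr.
apply: le_trans (small (eps / (M + 1)) (divr_gt0 eps0 M1)) _.
by rewrite mulrCA ger_pMr // ler_pdivrMr // mul1r lerDl.
Qed.

Lemma torus_integral_eq0 f : torus_fun f -> (forall x, 0 <= f x) ->
  torus_integral B f = 0 -> forall x, f x = 0.
Proof.
move=> tf f0 I0 x.
have /eqP := torus_integral_translate x tf; rewrite I0.
have dB : \det B != 0 by rewrite -unitfE -unitmxE.
rewrite /torus_integral mulf_eq0 normr_eq0 (negPf dB) /= => /eqP Ix.
have tfx : torus_fun (fun y => f (y + x)).
  split; first exact: smooth_translate tf.1.
  by move=> y z yz; apply: tf.2; rewrite torus_eqD.
have [K fK] := torus_fun_cube tfx.
have := cube_integral_eq0 fK (fun t => f0 _) Ix.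
by rewrite mul0mx add0r.
Qed.

End TorusFunctions.

(** * Complex-valued periodic functions *)

Section ComplexTorusFunctions.
Variables (R : realType) (n : nat) (B : 'M[R]_n).
Hypothesis uB : B \in unitmx.
Implicit Types f g : 'rV[R]_n -> R[i].

Notation Re := complex.Re.
Notation Im := complex.Im.

Definition csmooth f :=
  smooth_on setT (fun x => Re (f x)) /\ smooth_on setT (fun x => Im (f x)).

Lemma csmooth_cst c : csmooth (fun=> c).
Proof. by split; exact: smooth_cst. Qed.

Lemma csmoothD f g : csmooth f -> csmooth g -> csmooth (fun x => f x + g x).
Proof.
move=> [rf jf] [rg jg]; split.
  by have := smoothD rf rg; congr smooth_on; apply/funext => x /=; case: (f x) (g x) => [? ?] [].
by have := smoothD jf jg; congr smooth_on; apply/funext => x /=; case: (f x) (g x) => [? ?] [].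
Qed.

Lemma csmoothM f g : csmooth f -> csmooth g -> csmooth (fun x => f x * g x).
Proof.
move=> [rf jf] [rg jg]; split.
  have := smoothD (smoothM rf rg) (smoothZ (-1) (smoothM jf jg)).
  congr smooth_on; apply/funext => x /=; case: (f x) (g x) => [a b] [c d] /=.
  by rewrite mulN1r.
have := smoothD (smoothM rf jg) (smoothM jf rg).
by congr smooth_on; apply/funext => x /=; case: (f x) (g x) => [a b] [c d].
Qed.

Lemma csmooth_conj f : csmooth f -> csmooth (fun x => (f x)^*%C).
Proof.
move=> [rf jf]; split.
  by have := rf; congr smooth_on; apply/funext => x /=; case: (f x).
have := smoothZ (-1) jf; congr smooth_on; apply/funext => x /=.
by case: (f x) => a b /=; rewrite mulN1r.
Qed.

Lemma csmooth_partial f j : csmooth f -> csmooth (cpartial j f).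
Proof. by move=> [rf jf]; split; exact: smooth_partial. Qed.

Lemma csmooth_sum (I : finType) (P : pred I) (F : I -> 'rV[R]_n -> R[i]) :
  (forall i, P i -> csmooth (F i)) -> csmooth (fun x => \sum_(i | P i) F i x).
Proof.
move=> H; rewrite (_ : (fun x => _) = \sum_(i | P i) F i).
  by apply: (big_ind (fun f => csmooth f)); [exact: csmooth_cst|exact: csmoothD|exact: H].
by apply/funext => x; rewrite fct_sumE.
Qed.

Lemma eq_complex (x y : R[i]) : Re x = Re y -> Im x = Im y -> x = y.
Proof. by case: x y => [a b] [c d] /= -> ->. Qed.

Lemma ReD (x y : R[i]) : Re (x + y) = Re x + Re y.
Proof. by case: x y => [a b] []. Qed.

Lemma ImD (x y : R[i]) : Im (x + y) = Im x + Im y.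
Proof. by case: x y => [a b] []. Qed.

Lemma cpartialD f g j : csmooth f -> csmooth g ->
  cpartial j (fun x => f x + g x) = fun x => cpartial j f x + cpartial j g x.
Proof.
move=> [rf jf] [rg jg].
have Er : (fun x => Re (f x + g x)) = (fun x => Re (f x)) \+ (fun x => Re (g x)).
  by apply/funext => x; exact: ReD.
have Ei : (fun x => Im (f x + g x)) = (fun x => Im (f x)) \+ (fun x => Im (g x)).
  by apply/funext => x; exact: ImD.
by apply/funext => x; rewrite /cpartial Er Ei (partialD j rf rg) (partialD j jf jg).
Qed.

Lemma cpartialM f g j : csmooth f -> csmooth g ->
  cpartial j (fun x => f x * g x) =
  fun x => cpartial j f x * g x + f x * cpartial j g x.
Proof.
move=> [rf jf] [rg jg].
have Er : (fun x => Re (f x * g x)) = ((fun x => Re (f x)) \* (fun x => Re (g x))) \+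
    (fun x => -1 * ((fun x => Im (f x)) \* (fun x => Im (g x))) x).
  by apply/funext => x /=; case: (f x) (g x) => [a b] [c d] /=; rewrite mulN1r.
have Ei : (fun x => Im (f x * g x)) = ((fun x => Re (f x)) \* (fun x => Im (g x))) \+
    ((fun x => Im (f x)) \* (fun x => Re (g x))).
  by apply/funext => x /=; case: (f x) (g x) => [a b] [c d].
apply/funext => x; rewrite /cpartial Er Ei.
rewrite (partialD j (smoothM rf rg) (smoothZ (-1) (smoothM jf jg))).
rewrite (partialD j (smoothM rf jg) (smoothM jf rg)).
rewrite (partialZ (-1) j (smoothM jf jg)) (partialM j rf rg) (partialM j jf jg).
rewrite (partialM j rf jg) (partialM j jf rg) /=.
by case: (f x) (g x) => [a b] [c d]; apply: eq_complex => /=; ring.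
Qed.

Lemma cpartial_cst (c : R[i]) j : cpartial j (fun _ : 'rV[R]_n => c) = fun=> 0.
Proof. by apply/funext => x; apply: eq_complex; exact: derive_cst. Qed.

Lemma cpartialZ c f j : csmooth f ->
  cpartial j (fun x => c * f x) = fun x => c * cpartial j f x.
Proof.
move=> sf; rewrite (cpartialM j (csmooth_cst c) sf).
by apply/funext => x; rewrite cpartial_cst mul0r add0r.
Qed.

Lemma cpartial_conj f j : csmooth f ->
  cpartial j (fun x => (f x)^*%C) = fun x => (cpartial j f x)^*%C.
Proof.
move=> [rf jf].
have Er : (fun x => Re (f x)^*%C) = (fun x => Re (f x)).
  by apply/funext => x; case: (f x).
have Ei : (fun x => Im (f x)^*%C) = (fun x => -1 * Im (f x)).
  by apply/funext => x; case: (f x) => a b /=; rewrite mulN1r.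
apply/funext => x; rewrite /cpartial Er Ei (partialZ (-1) j jf).
by apply: eq_complex => //=; rewrite mulN1r.
Qed.

Lemma cpartial_translate f v j :
  cpartial j (fun x => f (x + v)) = fun x => cpartial j f (x + v).
Proof.
by apply/funext => x; apply: eq_complex; rewrite /cpartial /= /partial
  -derive_translate.
Qed.

Lemma csmooth_translate f v : csmooth f -> csmooth (fun x => f (x + v)).
Proof.
move=> [rf jf]; split.
  exact: (smooth_translate v rf).
exact: (smooth_translate v jf).
Qed.

Definition torus_cfun f := csmooth f /\ forall x y, torus_eq B x y -> f x = f y.

Lemma torus_cfunRe f : torus_cfun f -> torus_fun B (fun x => Re (f x)).
Proof. by move=> [[rf jf] pf]; split => // x y /pf ->. Qed.

Lemma torus_cfunIm f : torus_cfun f -> torus_fun B (fun x => Im (f x)).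
Proof. by move=> [[rf jf] pf]; split => // x y /pf ->. Qed.

Lemma torus_cfun_cst c : torus_cfun (fun=> c).
Proof. by split; first exact: csmooth_cst. Qed.

Lemma torus_cfunD f g : torus_cfun f -> torus_cfun g -> torus_cfun (fun x => f x + g x).
Proof.
by move=> [sf pf] [sg pg]; split; [exact: csmoothD|move=> x y xy; rewrite (pf _ _ xy) (pg _ _ xy)].
Qed.

Lemma torus_cfunM f g : torus_cfun f -> torus_cfun g -> torus_cfun (fun x => f x * g x).
Proof.
by move=> [sf pf] [sg pg]; split; [exact: csmoothM|move=> x y xy; rewrite (pf _ _ xy) (pg _ _ xy)].
Qed.

Lemma torus_cfun_conj f : torus_cfun f -> torus_cfun (fun x => (f x)^*%C).
Proof.
by move=> [sf pf]; split; [exact: csmooth_conj|move=> x y xy; rewrite (pf _ _ xy)].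
Qed.

Lemma torus_cfun_partial f j : torus_cfun f -> torus_cfun (cpartial j f).
Proof.
move=> tf; split; first by apply: csmooth_partial; case: tf.
move=> x y xy; apply: eq_complex.
  exact: (torus_fun_partial j (torus_cfunRe tf)).2.
exact: (torus_fun_partial j (torus_cfunIm tf)).2.
Qed.

Lemma torus_cfun_sum (I : finType) (P : pred I) (F : I -> 'rV[R]_n -> R[i]) :
  (forall i, P i -> torus_cfun (F i)) -> torus_cfun (fun x => \sum_(i | P i) F i x).
Proof.
move=> H; split; first by apply: csmooth_sum => i /H[].
by move=> x y xy; apply: eq_bigr => i /H[_]; apply.
Qed.

Lemma torus_cintegralD f g : torus_cfun f -> torus_cfun g ->
  torus_cintegral B (fun x => f x + g x) = torus_cintegral B f + torus_cintegral B g.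
Proof.
move=> tf tg; apply: eq_complex; rewrite ?ReD ?ImD /=.
  rewrite -(torus_integralD uB (torus_cfunRe tf) (torus_cfunRe tg)).
  by congr torus_integral; apply/funext => x; rewrite ReD.
rewrite -(torus_integralD uB (torus_cfunIm tf) (torus_cfunIm tg)).
by congr torus_integral; apply/funext => x; rewrite ImD.
Qed.

Lemma torus_cintegral0 : torus_cintegral B (fun=> 0) = 0.
Proof. by apply: eq_complex; rewrite /= torus_integral0. Qed.

Lemma torus_cintegral_sum (I : finType) (P : pred I) (F : I -> 'rV[R]_n -> R[i]) :
  (forall i, P i -> torus_cfun (F i)) ->
  torus_cintegral B (fun x => \sum_(i | P i) F i x) =
  \sum_(i | P i) torus_cintegral B (F i).
Proof.
move=> H; rewrite (_ : (fun x => _) = \sum_(i | P i) F i); last first.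
  by apply/funext => x; rewrite fct_sumE.
suff [] : torus_cfun (\sum_(i | P i) F i) /\ torus_cintegral B (\sum_(i | P i) F i) =
   \sum_(i | P i) torus_cintegral B (F i) by [].
apply: (big_ind2 (fun f s => torus_cfun f /\ torus_cintegral B f = s)).
- by split; [exact: torus_cfun_cst|exact: torus_cintegral0].
- move=> f df g dg [sf <-] [sg <-]; split; first exact: torus_cfunD.
  exact: torus_cintegralD.
- by move=> i Pi; split=> //; exact: H.
Qed.

Lemma torus_cintegral_partial f j : torus_cfun f -> torus_cintegral B (cpartial j f) = 0.
Proof.
move=> tf; apply: eq_complex.
  exact: (torus_integral_partial uB j (torus_cfunRe tf)).
exact: (torus_integral_partial uB j (torus_cfunIm tf)).
Qed.

End ComplexTorusFunctions.

(** * The codifferential of a flat torus *)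

(** The sign of [dx_j /\ dx_(J :\ j)], as a multiple of [dx_J]. *)
Definition ext_sign (R : realType) (n : nat) (J : {set 'I_n}) (j : 'I_n) : R[i] :=
  (-1) ^+ #|[pred i in J | (i < j)%N]|.

(** The operator [- \sum_j iota_j \o partial_j], the closed form of the
    codifferential of a flat metric. *)
Definition divergence (R : realType) (n : nat) (w : dform R n) : dform R n :=
  fun I x => - \sum_(j | j \notin I) ext_sign R (j |: I) j * cpartial j (w (j |: I)) x.

Section Codifferential.
Variables (R : realType) (n : nat) (B : 'M[R]_n).
Hypothesis uB : B \in unitmx.
Implicit Types w theta eta : dform R n.

Lemma torus_formP w : torus_form B w <-> forall I, torus_cfun B (w I).
Proof.
split=> [H I|H I]; first by have [] := H I.
by have [[] ] := H I.
Qed.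

Lemma conjcN (x : R[i]) : conjc (- x) = - conjc x.
Proof. exact: (rmorphN (@conjc R)). Qed.

Lemma conjcM (x y : R[i]) : conjc (x * y) = conjc x * conjc y.
Proof. exact: (rmorphM (@conjc R)). Qed.

Lemma conjc_sum (I : finType) (P : pred I) (F : I -> R[i]) :
  conjc (\sum_(i | P i) F i) = \sum_(i | P i) conjc (F i).
Proof. exact: (rmorph_sum (@conjc R)). Qed.

Lemma ext_sign_conj (J : {set 'I_n}) j : ((ext_sign R J j)^*)%C = ext_sign R J j.
Proof.
by rewrite /ext_sign rmorphXn rmorphN rmorph1.
Qed.

Lemma torus_form_ext_d w : torus_form B w -> torus_form B (ext_d w).
Proof.
move=> /torus_formP tw; apply/torus_formP => J; apply: torus_cfun_sum => j _.
by apply: torus_cfunM; [exact: torus_cfun_cst|exact: torus_cfun_partial].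
Qed.

Lemma torus_form_divergence w : torus_form B w -> torus_form B (divergence w).
Proof.
move=> /torus_formP tw; apply/torus_formP => J.
have -> : divergence w J = fun x => -1 * \sum_(j | j \notin J)
     ext_sign R (j |: J) j * cpartial j (w (j |: J)) x.
  by apply/funext => x; rewrite mulN1r.
apply: torus_cfunM; first exact: torus_cfun_cst.
apply: torus_cfun_sum => j _.
by apply: torus_cfunM; [exact: torus_cfun_cst|exact: torus_cfun_partial].
Qed.

(** The pairs of a set and a point outside it correspond to the pairs of a set and
    a point of it. *)
Lemma sum_set_remove (G : {set 'I_n} -> 'I_n -> R[i]) :
  \sum_(I : {set 'I_n}) \sum_(j | j \notin I) G I j =
  \sum_(J : {set 'I_n}) \sum_(j in J) G (J :\ j) j.
Proof.
rewrite (exchange_big_dep xpredT) //= [RHS](exchange_big_dep xpredT) //=.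
apply: eq_bigr => j _.
rewrite [LHS](reindex_onto (fun J : {set 'I_n} => J :\ j) (fun I : {set 'I_n} => j |: I)) /=.
  apply: eq_bigl => J; rewrite setD11 /=.
  apply/eqP/idP => [<-|]; first exact: setU11.
  exact: finset.setD1K.
by move=> I jI; rewrite finset.setU1K.
Qed.

Let pairing theta w : 'rV[R]_n -> R[i] := fun x => \sum_(I : {set 'I_n}) theta I x * (w I x)^*%C.

Let pairing_cfun theta w : torus_form B theta -> torus_form B w ->
  torus_cfun B (pairing theta w).
Proof.
move=> /torus_formP tt /torus_formP tw; apply: torus_cfun_sum => I _.
by apply: torus_cfunM; [exact: tt|apply: torus_cfun_conj; exact: tw].
Qed.

(* The failure of the pointwise adjunction is a sum of partial derivatives. *)
Let pairing_leibniz theta w x : torus_form B theta -> torus_form B w ->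
  pairing (ext_d theta) w x = pairing theta (divergence w) x +
  \sum_(J : {set 'I_n}) \sum_(j in J) ext_sign R J j *
     cpartial j (fun y => theta (J :\ j) y * (w J y)^*%C) x.
Proof.
move=> /torus_formP tt /torus_formP tw.
have -> : pairing theta (divergence w) x =
    - \sum_(I : {set 'I_n}) \sum_(j | j \notin I)
       ext_sign R (j |: I) j * (theta I x * (cpartial j (w (j |: I)) x)^*%C).
  rewrite -sumrN; apply: eq_bigr => I _.
  rewrite /divergence conjcN mulrN conjc_sum mulr_sumr.
  congr (- _); apply: eq_bigr => j _.
  by rewrite conjcM ext_sign_conj mulrCA.
rewrite (sum_set_remove (fun I j =>
  ext_sign R (j |: I) j * (theta I x * (cpartial j (w (j |: I)) x)^*%C))).
rewrite [RHS]addrC -sumrB; apply: eq_bigr => J _.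
rewrite /ext_d mulr_suml -sumrB; apply: eq_bigr => j jJ.
rewrite finset.setD1K // cpartialM; last by apply: csmooth_conj; case: (tw J).
  rewrite cpartial_conj; last by case: (tw J).
  by rewrite -/(ext_sign R J j) mulrDr addrK mulrA.
by case: (tt (J :\ j)).
Qed.

Lemma form_inner_divergence theta w : torus_form B theta -> torus_form B w ->
  form_inner B (ext_d theta) w = form_inner B theta (divergence w).
Proof.
move=> tt tw; rewrite /form_inner.
rewrite -/(pairing theta (divergence w)) -/(pairing (ext_d theta) w).
pose C J j := cpartial j (fun y => theta (J :\ j) y * (w J y)^*%C).
have tC J j : torus_cfun B (fun y => theta (J :\ j) y * (w J y)^*%C).
  move/torus_formP in tt; move/torus_formP in tw.
  by apply: torus_cfunM => //; exact: torus_cfun_conj.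
have tC' J j : torus_cfun B (fun x => ext_sign R J j * C J j x).
  by apply: torus_cfunM; [exact: torus_cfun_cst|exact: torus_cfun_partial].
pose S (J : {set 'I_n}) x := \sum_(j in J) ext_sign R J j * C J j x.
have tS J : torus_cfun B (S J) by apply: torus_cfun_sum => j _; exact: tC'.
have -> : pairing (ext_d theta) w = fun x => pairing theta (divergence w) x +
    \sum_(J : {set 'I_n}) S J x.
  by apply/funext => x; exact: pairing_leibniz.
rewrite torus_cintegralD //; last first.
- by apply: torus_cfun_sum.
- by apply: pairing_cfun => //; exact: torus_form_divergence.
rewrite [X in _ + X]torus_cintegral_sum // [X in _ + X]big1 ?addr0 // => J _.
rewrite /S (torus_cintegral_sum uB (F := fun j x => ext_sign R J j * C J j x)); last first.
  by move=> j _; exact: tC'.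
apply: big1 => j _.
have <- : cpartial j (fun y => ext_sign R J j * (theta (J :\ j) y * (w J y)^*%C)) =
     fun x => ext_sign R J j * C J j x.
  by rewrite cpartialZ //; case: (tC J j).
apply: torus_cintegral_partial => //.
by apply: torus_cfunM; [exact: torus_cfun_cst|exact: tC].
Qed.

Lemma torus_formB w eta : torus_form B w -> torus_form B eta ->
  torus_form B (fun I x => w I x - eta I x).
Proof.
move=> /torus_formP tw /torus_formP te; apply/torus_formP => I.
rewrite (_ : (fun x => _) = fun x => w I x + -1 * eta I x); last first.
  by apply/funext => x; rewrite mulN1r.
apply: torus_cfunD => //; apply: torus_cfunM => //; exact: torus_cfun_cst.
Qed.

(** Test with the difference of the two forms. *)
Lemma form_inner_nondegenerate w eta : torus_form B w -> torus_form B eta ->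
  (forall theta, torus_form B theta -> form_inner B theta w = form_inner B theta eta) ->
  w = eta.
Proof.
move=> tw te H; pose d : dform R n := fun I x => w I x - eta I x.
have td : torus_form B d by exact: torus_formB.
have I0 : torus_cintegral B (pairing d d) = 0.
  have := H d td; rewrite /form_inner -/(pairing d w) -/(pairing d eta).
  have -> : pairing d w = fun x => pairing d d x + pairing d eta x.
    apply/funext => x; rewrite -big_split; apply: eq_bigr => I _ /=.
    by rewrite -mulrDr -raddfD /= subrK.
  rewrite torus_cintegralD //; [|exact: pairing_cfun|exact: pairing_cfun].
  by move=> /eqP; rewrite -[X in _ == X]add0r (inj_eq (addIr _)) => /eqP.
have RE x : complex.Re (pairing d d x) = \sum_(I : {set 'I_n})
    (complex.Re (d I x) ^+ 2 + complex.Im (d I x) ^+ 2).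
  rewrite /pairing (big_morph (@complex.Re R) (@ReD R) (erefl : complex.Re (0 : R[i]) = 0)).
  by apply: eq_bigr => I _; case: (d I x) => a b /=; ring.
have tR := torus_cfunRe (pairing_cfun td td).
have P0 x : complex.Re (pairing d d x) = 0.
  apply: (torus_integral_eq0 uB tR) => [{}x|]; last by case: I0.
  by rewrite RE; apply: sumr_ge0 => I _; rewrite addr_ge0 // sqr_ge0.
apply/funext => I; apply/funext => x; apply/eqP; rewrite -subr_eq0 -/(d I x).
have /eqP := P0 x; rewrite RE psumr_eq0; last first.
  by move=> J _; rewrite addr_ge0 // sqr_ge0.
move=> /allP/(_ I (mem_index_enum _)) /=.
rewrite paddr_eq0 ?sqr_ge0 // !sqrf_eq0; case: (d I x) => a b /= /andP[/eqP -> /eqP ->].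
by [].
Qed.

(** The codifferential does not depend on the lattice, which is why the operator
    can be transported from one torus to another. *)
Lemma codiffE w : torus_form B w -> codiff B w = divergence w.
Proof.
move=> tw; apply: xget_unique.
  split; first exact: torus_form_divergence.
  by move=> theta tt; exact: form_inner_divergence.
move=> eta [te He]; apply: form_inner_nondegenerate => //.
  exact: torus_form_divergence.
by move=> theta tt; rewrite -He // form_inner_divergence.
Qed.

End Codifferential.

(** * Transplantation in a module *)

(** Model: [V] splits into a common subspace and [m] further ones, [P k] is the
    projection on the sum of the common one and the [k]-th, and the involution
    [S k] commutes with all projections. *)
Section Involution.
Variables (K : numFieldType) (V : lmodType K) (m : nat).
Hypothesis m_gt1 : (1 < m)%N.
Variables (P S : 'I_m -> V -> V) (k0 : 'I_m).
Hypothesis Plin : forall k, linear (P k).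
Hypothesis Slin : forall k, linear (S k).
Hypothesis SS : forall k u, S k (S k u) = u.
Hypothesis PS : forall j k u, P j (S k u) = S k (P j u).

(** The projection on the common subspace: adding up all [P k] counts it [m] times
    and every other component once. *)
Definition common_part (u : V) : V := m.-1%:R^-1 *: (\sum_k P k u - u).

(** Apply [S k] on the [k]-th component, and [S k0] on the common one. *)
Definition transplant (u : V) : V :=
  S k0 (common_part u) + \sum_k S k (P k u - common_part u).

Notation Q := common_part.
Notation T := transplant.

Let m1 : (m.-1%:R : K) != 0.
Proof. by rewrite pnatr_eq0; case: m m_gt1 => [|[]]. Qed.

HB.instance Definition _ k := GRing.isLinear.Build K V V *:%R (P k) (Plin k).
HB.instance Definition _ k := GRing.isLinear.Build K V V *:%R (S k) (Slin k).

Let PZ k a u : P k (a *: u) = a *: P k u. Proof. exact: linearZ. Qed.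
Let PD k u v : P k (u + v) = P k u + P k v. Proof. exact: linearD. Qed.
Let PB k u v : P k (u - v) = P k u - P k v. Proof. exact: linearB. Qed.
Let Psum k (F : 'I_m -> V) : P k (\sum_i F i) = \sum_i P k (F i).
Proof. exact: linear_sum. Qed.
Let S0 k : S k 0 = 0. Proof. exact: linear0. Qed.

Let sum_const_Q (u : V) : \sum_(k < m) u = u + m.-1%:R *: u.
Proof.
rewrite sumr_const card_ord scaler_nat.
by case: m m_gt1 => [|m'] // _; rewrite mulrS.
Qed.

Let mQ u : m.-1%:R *: Q u = \sum_k P k u - u.
Proof. by rewrite /Q scalerA mulfV ?m1 // scale1r. Qed.

(** The relations between the projections are required at [u] only, because in the
    application they hold for periodic forms only. *)
Lemma transplant_involutive u :
  (forall j k, P j (P k u) = if j == k then P k u else Q u) -> T (T u) = u.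
Proof.
move=> PP.
have sumPP j : \sum_k P j (P k u) = P j u + m.-1%:R *: Q u.
  rewrite (bigD1 j) //= PP eqxx; congr (_ + _).
  rewrite (eq_bigr (fun=> Q u)); last first.
    by move=> k kj; rewrite PP eq_sym (negPf kj).
  by rewrite sumr_const cardC1 card_ord scaler_nat.
have PQ j : P j (Q u) = Q u.
  rewrite {1}/Q PZ PB Psum sumPP addrAC subrr add0r.
  by rewrite scalerA mulVf // scale1r.
have PT j : P j (T u) = S k0 (Q u) + S j (P j u - Q u).
  rewrite /T PD PS PQ; congr (_ + _).
  rewrite Psum (bigD1 j) //= PS PB PP eqxx PQ big1 ?addr0 // => k kj.
  by rewrite PS PB PP eq_sym (negPf kj) PQ subrr S0.
have QT : Q (T u) = S k0 (Q u).
  rewrite {1}/Q (eq_bigr _ (fun j _ => PT j)) big_split /= sum_const_Q.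
  by rewrite /T opprD addrACA subrr addr0 addrAC subrr add0r scalerA mulVf // scale1r.
rewrite {1}/T QT SS.
rewrite (eq_bigr (fun k => P k u - Q u)); last first.
  by move=> k _; rewrite PT addrAC subrr add0r SS.
rewrite sumrB sum_const_Q mQ opprD opprB addrCA [Q u + _]addrA subrr add0r.
by rewrite addrC subrK.
Qed.

End Involution.

(** * Operators commuting with the exterior derivative and the codifferential *)

Section NaturalOperators.
Variables (R : realType) (n : nat).
Local Notation form := ({set 'I_n} -> 'rV[R]_n -> R[i]^o).
Implicit Types (w : form) (Phi Psi : form -> form).

Definition smooth_form (w : dform R n) := forall I, csmooth (w I).

(** The linear operators on forms that commute with the exterior derivative and
    the codifferential. *)
Record natural_op Phi : Prop := NaturalOp {
  natural_lin : linear Phi;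
  natural_smooth : forall w, smooth_form w -> smooth_form (Phi w);
  natural_d : forall w, smooth_form w -> ext_d (Phi w) = Phi (ext_d w);
  natural_div : forall w, smooth_form w -> divergence (Phi w) = Phi (divergence w) }.

Lemma smooth_ext_d w : smooth_form w -> smooth_form (ext_d w).
Proof.
move=> sw J; apply: csmooth_sum => j _.
by apply: csmoothM; [exact: csmooth_cst|exact: csmooth_partial].
Qed.

Lemma smooth_divergence w : smooth_form w -> smooth_form (divergence w).
Proof.
move=> sw J; have -> : divergence w J = fun x => -1 * \sum_(j | j \notin J)
     ext_sign R (j |: J) j * cpartial j (w (j |: J)) x.
  by apply/funext => x; rewrite mulN1r.
apply: csmoothM; first exact: csmooth_cst.
apply: csmooth_sum => j _.
by apply: csmoothM; [exact: csmooth_cst|exact: csmooth_partial].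
Qed.

Lemma cpartial_lin (f g : 'rV[R]_n -> R[i]) a j : csmooth f -> csmooth g ->
  cpartial j (fun x => a * f x + g x) = fun x => a * cpartial j f x + cpartial j g x.
Proof.
move=> sf sg; have sa := csmoothM (csmooth_cst n a) sf.
by rewrite (cpartialD j sa sg) (cpartialZ a j sf).
Qed.

Lemma ext_d_lin a w1 w2 : smooth_form w1 -> smooth_form w2 ->
  ext_d (a *: w1 + w2 : form) = (a *: (ext_d w1 : form) + ext_d w2 : form).
Proof.
move=> s1 s2; apply/funext => J; apply/funext => x.
transitivity (\sum_(j in J) ext_sign R J j *
    (a * cpartial j (w1 (J :\ j)) x + cpartial j (w2 (J :\ j)) x)).
  apply: eq_bigr => j _; congr (_ * _).
  by have /(congr1 (fun h => h x)) := cpartial_lin a j (s1 (J :\ j)) (s2 (J :\ j)).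
transitivity (a * ext_d w1 J x + ext_d w2 J x); last by [].
rewrite /ext_d mulr_sumr -big_split; apply: eq_bigr => j _ /=.
by rewrite -/(ext_sign R J j); ring.
Qed.

Lemma divergence_lin a w1 w2 : smooth_form w1 -> smooth_form w2 ->
  divergence (a *: w1 + w2 : form) = (a *: (divergence w1 : form) + divergence w2 : form).
Proof.
move=> s1 s2; apply/funext => J; apply/funext => x.
transitivity (- \sum_(j | j \notin J) ext_sign R (j |: J) j *
    (a * cpartial j (w1 (j |: J)) x + cpartial j (w2 (j |: J)) x)).
  congr (- _); apply: eq_bigr => j _; congr (_ * _).
  by have /(congr1 (fun h => h x)) := cpartial_lin a j (s1 (j |: J)) (s2 (j |: J)).
transitivity (a * divergence w1 J x + divergence w2 J x); last by [].
rewrite /divergence mulrN mulr_sumr -opprD -big_split; congr (- _).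
by apply: eq_bigr => j _ /=; ring.
Qed.

Lemma smooth_form_lin a w1 w2 : smooth_form w1 -> smooth_form w2 ->
  smooth_form (a *: w1 + w2 : form).
Proof.
move=> s1 s2 I; apply: (@csmoothD _ _ (fun x => a * w1 I x) (w2 I)) => //.
by apply: csmoothM => //; exact: csmooth_cst.
Qed.

Lemma natural_id : natural_op id.
Proof. by split. Qed.

Lemma natural_comb a Phi Psi : natural_op Phi -> natural_op Psi ->
  natural_op (fun w => a *: Phi w + Psi w).
Proof.
move=> [lP sP dP vP] [lQ sQ dQ vQ]; split.
- move=> c u v; rewrite lP lQ !scalerDr !scalerA mulrC.
  by rewrite addrACA.
- by move=> w sw; apply: smooth_form_lin; [exact: sP|exact: sQ].
- by move=> w sw; rewrite (ext_d_lin a (sP w sw) (sQ w sw)) (dP w sw) (dQ w sw).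
- by move=> w sw; rewrite (divergence_lin a (sP w sw) (sQ w sw)) (vP w sw) (vQ w sw).
Qed.

Lemma natural_comp Phi Psi : natural_op Phi -> natural_op Psi -> natural_op (Phi \o Psi).
Proof.
move=> [lP sP dP vP] [lQ sQ dQ vQ]; split.
- by move=> c u v; rewrite /= lQ lP.
- by move=> w sw; apply: sP; exact: sQ.
- by move=> w sw; rewrite /= (dP _ (sQ w sw)) (dQ w sw).
- by move=> w sw; rewrite /= (vP _ (sQ w sw)) (vQ w sw).
Qed.

Lemma natural0 : natural_op (fun=> 0).
Proof.
have -> : (fun=> 0) = (fun w : form => -1 *: id w + id w).
  by apply/funext => w; rewrite scaleN1r addNr.
by apply: natural_comb; exact: natural_id.
Qed.

Lemma natural_scale a Phi : natural_op Phi -> natural_op (fun w => a *: Phi w).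
Proof.
move=> nP; have := natural_comb a nP natural0.
by congr natural_op; apply/funext => w; rewrite addr0.
Qed.

Lemma naturalD Phi Psi : natural_op Phi -> natural_op Psi ->
  natural_op (fun w => Phi w + Psi w).
Proof.
move=> nP nQ; have := natural_comb 1 nP nQ.
by congr natural_op; apply/funext => w; rewrite scale1r.
Qed.

Lemma naturalB Phi Psi : natural_op Phi -> natural_op Psi ->
  natural_op (fun w => Phi w - Psi w).
Proof.
move=> nP nQ; have := naturalD nP (natural_scale (-1) nQ).
by congr natural_op; apply/funext => w; rewrite scaleN1r.
Qed.

Lemma natural_sum (I : finType) (Phi : I -> form -> form) :
  (forall i, natural_op (Phi i)) -> natural_op (fun w => \sum_i Phi i w).
Proof.
move=> nP; elim: (index_enum I) => [|i s IH].
  by have := natural0; congr natural_op; apply/funext => w; rewrite big_nil.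
have := naturalD (nP i) IH.
by congr natural_op; apply/funext => w; rewrite big_cons.
Qed.

Definition translate (v : 'rV[R]_n) w : form := fun I x => w I (x + v).

Lemma natural_translate v : natural_op (translate v).
Proof.
split; [by []|move=> w sw|move=> w sw|move=> w sw].
- by move=> I; exact: csmooth_translate (sw I).
- apply/funext => J; apply/funext => x; apply: eq_bigr => j _; congr (_ * _).
  by rewrite /translate cpartial_translate.
- apply/funext => J; apply/funext => x; congr (- _); apply: eq_bigr => j _; congr (_ * _).
  by rewrite /translate cpartial_translate.
Qed.

Definition flip (k : 'I_n) (x : 'rV[R]_n) : 'rV[R]_n :=
  \row_j (if j == k then - x 0 j else x 0 j).

Lemma flipK k : involutive (flip k).
Proof. by move=> x; apply/rowP => j; rewrite !mxE; case: eqP; rewrite ?opprK. Qed.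

Lemma flipD k x y : flip k (x + y) = flip k x + flip k y.
Proof. by apply/rowP => j; rewrite !mxE; case: eqP; rewrite ?opprD. Qed.

Lemma flipZ k a x : flip k (a *: x) = a *: flip k x.
Proof. by apply/rowP => j; rewrite !mxE; case: eqP; rewrite ?mulrN. Qed.

Lemma flip_delta k j : flip k (delta_mx 0 j) = (-1) ^+ (j == k) *: delta_mx 0 j.
Proof.
apply/rowP => i; rewrite !mxE eqxx /=; case: (eqVneq i j) => [->|ij].
  by case: (j == k); rewrite mulr1 ?expr1 ?expr0.
by rewrite mulr0 oppr0 if_same.
Qed.

Lemma flip_continuous k (x : 'rV[R]_n) : {for x, continuous (flip k)}.
Proof.
move=> A /nbhs_ballP[e /= e0 eA]; apply/nbhs_ballP; exists e => // y /=.
move=> /(rV_ballP _ _ e0) xy; apply: eA.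
apply/rV_ballP => // j; rewrite !mxE; case: ifP => _; last exact: xy.
by rewrite -opprD normrN.
Qed.

Lemma partial_flip (f : 'rV[R]_n -> R) k j : smooth_on setT f ->
  (forall x, derivable (f \o flip k) x (delta_mx 0 j)) /\
  partial j (f \o flip k) = fun x => (-1) ^+ (j == k) * partial j f (flip k x).
Proof.
move=> sf; pose e : 'rV[R]_n := delta_mx 0 j.
suff H x : is_derive x e (f \o flip k) ((-1) ^+ (j == k) * partial j f (flip k x)).
  by split=> [x|]; [have [] := H x|apply/funext => x; have [_] := H x].
have df : derivable f (flip k x) e by exact: smooth_derivable.
have E (h : R) : (f \o flip k \o shift x) (h *: e) =
   (f \o shift (flip k x)) (h *: ((-1) ^+ (j == k) *: e)).
  by rewrite /= flipD flipZ flip_delta.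
case jk : (j == k) in E *; last first.
  rewrite expr0 mul1r in E *.
  have EQ : (fun h : R => h^-1 *: ((f \o flip k \o shift x) (h *: e) - (f \o flip k) x)) =
    (fun h : R => h^-1 *: ((f \o shift (flip k x)) (h *: e) - f (flip k x))).
    by apply/funext => h; rewrite E scale1r.
  by split; rewrite /derivable /partial /derive EQ.
rewrite expr1 mulN1r in E *.
(* Replace the increment [h] by [- h] in the difference quotient. *)
have dN : is_derive (flip k x) (- e) f (- 'D_e f (flip k x)).
  have q : (fun h : R => h^-1 *: ((f \o shift (flip k x)) (h *: - e) - f (flip k x))) =
     (fun h : R => - ((fun h => h^-1 *: ((f \o shift (flip k x)) (h *: e) - f (flip k x))) (- h))).
    by apply/funext => h /=; rewrite scalerN -scaleNr invrN [(- h^-1) *: _]scaleNr opprK.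
  have c : (fun h : R => h^-1 *: ((f \o shift (flip k x)) (h *: - e) - f (flip k x))) @ 0^' -->
     - 'D_e f (flip k x).
    rewrite q; apply: cvgN.
    have oppc : -%R @ (0 : R)^' --> (0 : R)^'.
      move=> A [r /= r0 HA]; exists r => //= h /= bh hn0; apply: HA; rewrite ?oppr_eq0 //=.
      by move: bh; rewrite !sub0r normrN opprK.
    have cc := cvg_comp _ _ oppc df. exact: cc.
  split; first by apply/cvg_ex; exists (- 'D_e f (flip k x)).
  exact: cvg_lim c.
have EQ : (fun h : R => h^-1 *: ((f \o flip k \o shift x) (h *: e) - (f \o flip k) x)) =
    (fun h : R => h^-1 *: ((f \o shift (flip k x)) (h *: - e) - f (flip k x))).
  by apply/funext => h; rewrite E scaleN1r.
case: dN => dN1 dN2.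
by split; rewrite /derivable /partial /derive EQ.
Qed.

Lemma smooth_flip (f : 'rV[R]_n -> R) k : smooth_on setT f -> smooth_on setT (f \o flip k).
Proof.
move=> sf.
apply: (@smooth_coind _ _ (fun h => exists2 f, smooth_on setT f & h = f \o flip k)); last first.
  by exists f.
move=> _ [{}f {}sf ->]; split=> [|x j|j].
- have H (x : 'rV[R]_n) : {for x, continuous (f \o flip k)}.
    by apply: continuous_comp; [exact: flip_continuous|exact: smooth_continuous].
  exact: H.
- by have [+ _] := partial_flip k j sf; apply.
- exists (fun x => (-1) ^+ (j == k) * partial j f x).
    by apply: smoothZ; exact: smooth_partial.
  by have [_ ->] := partial_flip k j sf.
Qed.

Lemma csmooth_flip (f : 'rV[R]_n -> R[i]) k : csmooth f -> csmooth (f \o flip k).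
Proof. by move=> [rf jf]; split; [exact: (smooth_flip k rf)|exact: (smooth_flip k jf)]. Qed.

Lemma cpartial_flip (f : 'rV[R]_n -> R[i]) k j x : csmooth f ->
  cpartial j (f \o flip k) x = (-1) ^+ (j == k) * cpartial j f (flip k x).
Proof.
move=> [rf jf].
have /(congr1 (fun h => h x)) /= Er := (partial_flip k j rf).2.
have /(congr1 (fun h => h x)) /= Ei := (partial_flip k j jf).2.
rewrite /cpartial /= -[X in X +i* _]/(partial j ((fun y => complex.Re (f y)) \o flip k) x) Er.
rewrite -[X in _ +i* X]/(partial j ((fun y => complex.Im (f y)) \o flip k) x) Ei.
by case: (j == k); rewrite ?expr1 ?expr0 ?mul1r ?mulN1r.
Qed.

(** The pullback of forms by [flip k]: [dx_I] changes sign when [k] is in [I]. *)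
Definition reflect_form k w : form := fun I x => (-1) ^+ (k \in I) * w I (flip k x).

Lemma reflect_formK k w : reflect_form k (reflect_form k w) = w.
Proof.
apply/funext => I; apply/funext => x; rewrite /reflect_form flipK mulrA.
by rewrite -exprD addnn -mul2n exprM sqrrN expr1n expr1n mul1r.
Qed.

Lemma natural_reflect k : natural_op (reflect_form k).
Proof.
have D w I x : smooth_form w -> forall j, cpartial j (reflect_form k w I) x =
    (-1) ^+ (k \in I) * ((-1) ^+ (j == k) * cpartial j (w I) (flip k x)).
  move=> sw j; rewrite /reflect_form.
  have /(congr1 (fun h => h x)) /= -> :=
    cpartialZ ((-1) ^+ (k \in I)) j (csmooth_flip k (sw I)).
  by rewrite cpartial_flip.
split.
- move=> a u v; apply/funext => I; apply/funext => x.
  transitivity ((-1) ^+ (k \in I) * (a * u I (flip k x) + v I (flip k x)) : R[i]); first by [].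
  transitivity (a * ((-1) ^+ (k \in I) * u I (flip k x)) +
    (-1) ^+ (k \in I) * v I (flip k x) : R[i]); last by [].
  ring.
- move=> w sw I; apply: (@csmoothM _ _ (fun=> (-1) ^+ (k \in I)) (w I \o flip k)).
    exact: csmooth_cst.
  exact: csmooth_flip.
- move=> w sw; apply/funext => J; apply/funext => x; rewrite /ext_d {2}/reflect_form mulr_sumr.
  apply: eq_bigr => j jJ; rewrite D // [RHS]mulrCA; congr (_ * _).
  rewrite !mulrA; congr (_ * _); rewrite -exprD in_setD1.
  by case: (eqVneq k j) => [->|kj] /=; rewrite ?eqxx ?jJ ?addn0 ?(negPf kj).
- move=> w sw; apply/funext => J; apply/funext => x; rewrite /divergence {2}/reflect_form.
  rewrite mulrN mulr_sumr; congr (- _).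
  apply: eq_bigr => j jJ; rewrite D // [RHS]mulrCA; congr (_ * _).
  rewrite !mulrA; congr (_ * _); rewrite -exprD in_setU1.
  case: (eqVneq k j) => [->|kj] /=; first by rewrite ?eqxx (negPf jJ) ?sqrrN ?expr1n.
  by rewrite addn0.
Qed.

End NaturalOperators.

(** * The tetralattices *)

Section TetraLattice.
Variable m : nat.
Local Notation n := (4 + m)%N.

Definition row4 (T : nzRingType) (a b c d : T) : 'rV[T]_4 :=
  \row_j nth 0 [:: a; b; c; d] j.

(** The Conway-Sloane tetralattices, in integer coordinates, for [e = 1] and
    [e = -1]. The rows are orthogonal of squared norm 12. Modulo 3 the sign [e]
    disappears and the rows span the tetracode of length 4 over F_3; the sign is
    only seen modulo powers of 2. *)
Definition tetra_mx (e : int) : 'M[int]_4 :=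
  \matrix_(i, j) nth 0 (nth [::] [:: [:: 3 * e; -1; -1; -1]; [:: 1; 3 * e; -1; 1];
                          [:: 1; 1; 3 * e; -1]; [:: 1; -1; 1; 3 * e]] i) j.

Lemma row4E (z : 'rV[int]_4) : exists a b c d, z = row4 a b c d.
Proof.
exists (z 0 0), (z 0 1), (z 0 2%:R), (z 0 3%:R); apply/rowP => j; rewrite mxE.
by case: j => [[|[|[|[|//]]]] lj] /=; congr (z _ _); apply/val_inj.
Qed.

Lemma row4_tetra (e a b c d : int) : row4 a b c d *m tetra_mx e =
  row4 (3 * e * a + b + c + d) (- a + 3 * e * b + c - d)
       (- a - b + 3 * e * c + d) (- a + b - c + 3 * e * d).
Proof.
apply/rowP => j; rewrite !mxE !big_ord_recl big_ord0 !mxE.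
by case: j => [[|[|[|[|//]]]] lj] /=; ring.
Qed.

Definition ivec (y0 y1 y2 y3 : int) (t : 'rV[int]_m) : 'rV[int]_n :=
  row_mx (row4 y0 y1 y2 y3) t.

(** The coordinates of the lattice vectors, written out so that membership becomes
    linear integer arithmetic. *)
Definition in_tetra (e : int) (y : 'rV[int]_n) : Prop :=
  exists a b c d t, y = ivec (3 * e * a + b + c + d) (- a + 3 * e * b + c - d)
       (- a - b + 3 * e * c + d) (- a + b - c + 3 * e * d) t.

Lemma in_tetraP (e : int) (y : 'rV[int]_n) :
  in_tetra e y <-> exists z : 'rV[int]_n, y = z *m block_mx (tetra_mx e) 0 0 1%:M.
Proof.
have E (r : 'rV[int]_4) t : row_mx r t *m block_mx (tetra_mx e) 0 0 1%:M =
   row_mx (r *m tetra_mx e) t :> 'rV[int]_n.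
  by rewrite mul_row_block !mulmx0 mulmx1 addr0 add0r.
split=> [[a [b [c [d [t ->]]]]]|[z ->]].
  by exists (row_mx (row4 a b c d) t); rewrite E row4_tetra.
have [a [b [c [d lz]]]] := row4E (lsubmx z).
exists a, b, c, d, (rsubmx z).
by rewrite -{1}[z]hsubmxK E lz row4_tetra.
Qed.

(** The inverse of [tetra_mx e] is its transpose divided by 12. *)
Lemma in_tetra_dvd (e y0 y1 y2 y3 : int) t : e = 1 \/ e = -1 ->
  (12 %| 3 * e * y0 - y1 - y2 - y3)%Z -> (12 %| y0 + 3 * e * y1 - y2 + y3)%Z ->
  (12 %| y0 + y1 + 3 * e * y2 - y3)%Z -> (12 %| y0 - y1 + y2 + 3 * e * y3)%Z ->
  in_tetra e (ivec y0 y1 y2 y3 t).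
Proof.
move=> he /dvdzP[a Ea] /dvdzP[b Eb] /dvdzP[c Ec] /dvdzP[d Ed].
by exists a, b, c, d, t; congr ivec; case: he Ea Eb Ec Ed => -> Ea Eb Ec Ed; lia.
Qed.

(** Four times a basis vector. Since the lattice contains 12 times each basis
    vector, [axis k] has order 3 modulo the lattice; the factor 4 makes it
    invisible to the conditions modulo powers of 2. *)
Definition axis (k : 'I_4) : 'rV[int]_n :=
  ivec (4 *+ (k == 0)) (4 *+ (k == 1)) (4 *+ (k == 2%:R)) (4 *+ (k == 3%:R)) 0.

Lemma ivecD y0 y1 y2 y3 t z0 z1 z2 z3 u :
  ivec y0 y1 y2 y3 t + ivec z0 z1 z2 z3 u = ivec (y0 + z0) (y1 + z1) (y2 + z2) (y3 + z3) (t + u).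
Proof.
rewrite /ivec add_row_mx; congr row_mx; apply/rowP => j; rewrite !mxE.
by case: j => [[|[|[|[|//]]]] lj].
Qed.

Lemma ivecZ c y0 y1 y2 y3 t :
  c *: ivec y0 y1 y2 y3 t = ivec (c * y0) (c * y1) (c * y2) (c * y3) (c *: t).
Proof.
rewrite /ivec scale_row_mx; congr row_mx; apply/rowP => j; rewrite !mxE.
by case: j => [[|[|[|[|//]]]] lj].
Qed.

Lemma ivecN y0 y1 y2 y3 t : - ivec y0 y1 y2 y3 t = ivec (- y0) (- y1) (- y2) (- y3) (- t).
Proof. by rewrite -[LHS]scaleN1r ivecZ !mulN1r scaleN1r. Qed.

Definition iflip (k : 'I_4) (y : 'rV[int]_n) : 'rV[int]_n :=
  \row_j (if j == lshift m k then - y 0 j else y 0 j).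

Lemma iflip_ivec k y0 y1 y2 y3 t : iflip k (ivec y0 y1 y2 y3 t) =
  ivec (if k == 0 then - y0 else y0) (if k == 1 then - y1 else y1)
       (if k == 2%:R then - y2 else y2) (if k == 3%:R then - y3 else y3) t.
Proof.
apply/rowP => j; rewrite !mxE; case: (splitP j) => i ij.
  have -> : j = lshift m i by apply/val_inj.
  rewrite (inj_eq (@lshift_inj _ _)) eq_sym.
  rewrite !mxE.
  by case: i k {ij} => [[|[|[|[|//]]]] li] [[|[|[|[|//]]]] lk].
rewrite ifF //; apply/negbTE; apply/eqP => /(congr1 val) /=; rewrite ij /=.
by move: (ltn_ord k); lia.
Qed.

(** Changing the sign of one coordinate turns the conditions modulo powers of 2 for
    [e] into those for [- e]. It spoils those modulo 3 unless the coordinate is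
    divisible by 3, which a multiple of [axis k] repairs. *)
Lemma in_tetra_flip e k y : e = 1 \/ e = -1 -> in_tetra e y ->
  exists c : int, in_tetra (- e) (iflip k y + c *: axis k).
Proof.
move=> he [a [b [c [d [t ->]]]]].
move: he; set y0 := _ + d; set y1 := _ - d; set y2 := _ + d; set y3 := _ + _ => he.
(* The coordinate becomes [- y_k - 4 y_k = - 5 y_k], which is [y_k] modulo 3. *)
exists (- nth 0 [:: y0; y1; y2; y3] k).
rewrite iflip_ivec /axis ivecZ ivecD scaler0 addr0.
by case: k => [[|[|[|[|//]]]] lk] /=; apply: in_tetra_dvd; rewrite ?/y0 ?/y1 ?/y2 ?/y3;
  case: he => ->; lia.
Qed.

Lemma in_tetra_axis3 e k : e = 1 \/ e = -1 -> in_tetra e (3%:Z *: axis k).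
Proof.
move=> he; rewrite /axis ivecZ scaler0.
by case: k => [[|[|[|[|//]]]] lk] /=; apply: in_tetra_dvd => //; case: he => ->.
Qed.

(** For [j != k], the signed indices [(l1, s1)] and [(l2, s2)] such that the sum and
    the difference of [axis j] and [axis k] are [s1 axis l1] and [s2 axis l2] modulo
    the lattice, read off the words of weight 3 of the tetracode. The diagonal
    entries are dummies. *)
Definition tetracode (j k : 'I_4) : 'I_4 * int * ('I_4 * int) :=
  nth ((0, 0), (0, 0)) (nth [::]
   [:: [:: ((0, 0), (0, 0)); ((3%:R, 1), (2%:R, -1)); ((1, 1), (3%:R, -1)); ((2%:R, 1), (1, -1))];
       [:: ((3%:R, 1), (2%:R, 1)); ((0, 0), (0, 0)); ((3%:R, -1), (0, 1)); ((2%:R, -1), (0, -1))];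
       [:: ((1, 1), (3%:R, 1)); ((3%:R, -1), (0, -1)); ((0, 0), (0, 0)); ((1, -1), (0, 1))];
       [:: ((2%:R, 1), (1, 1)); ((2%:R, -1), (0, 1)); ((1, -1), (0, -1)); ((0, 0), (0, 0))]] j) k.

(** The tetracode is perfect: the nine elements 0 and [+- axis k] are exactly the
    group generated by the [axis k] modulo the lattice. *)
Lemma tetracodeP (e : int) (j k : 'I_4) : e = 1 \/ e = -1 -> j != k ->
  exists (l1 l2 : 'I_4) (s1 s2 : int),
  [/\ forall i : 'I_4, i \in [:: j; k; l1; l2],
     uniq [:: j; k; l1; l2], s1 = 1 \/ s1 = -1, s2 = 1 \/ s2 = -1 &
     in_tetra e (axis j + axis k - s1 *: axis l1) /\
     in_tetra e (axis j - axis k - s2 *: axis l2)].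
Proof.
move=> he jk; exists (tetracode j k).1.1, (tetracode j k).2.1.
exists (tetracode j k).1.2, (tetracode j k).2.2.
move: he jk; rewrite /axis !ivecZ !ivecN !ivecD !scaler0 !oppr0 !addr0.
case: j => [[|[|[|[|//]]]] lj]; case: k => [[|[|[|[|//]]]] lk] he //= _;
  (split; [by case=> [[|[|[|[|//]]]] li]|by []|by (left + right)|by (left + right)|]);
  by split; apply: in_tetra_dvd => //; case: he => ->.
Qed.

End TetraLattice.

(** * Transplantation of forms on tetralattice tori *)

Section TetraTorus.
Variables (R : realType) (m : nat).
Local Notation n := (4 + m)%N.
Variable d : 'rV[R]_n.
Local Notation form := ({set 'I_n} -> 'rV[R]_n -> R[i]^o).
Implicit Types (w u : form).

Definition tvec (y : 'rV[int]_n) : 'rV[R]_n := map_mx intr y *m diag_mx d.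

(** The lattice [in_tetra e], with orthogonal but not orthonormal axes: the [j]-th
    one is scaled by [d 0 j]. *)
Definition tetra_basis (e : int) : 'M[R]_n :=
  map_mx intr (block_mx (tetra_mx e) 0 0 1%:M : 'M[int]_n) *m diag_mx d.

Lemma tvecE y j : tvec y 0 j = (y 0 j)%:~R * d 0 j.
Proof. by rewrite /tvec mul_mx_diag !mxE. Qed.

Lemma tvecD y z : tvec (y + z) = tvec y + tvec z.
Proof. by rewrite /tvec map_mxD mulmxDl. Qed.

Lemma tvecZ c y : tvec (c *: y) = c%:~R *: tvec y.
Proof. by rewrite /tvec map_mxZ -scalemxAl. Qed.

Lemma tvecB y z : tvec (y - z) = tvec y - tvec z.
Proof. by rewrite tvecD -scaleN1r tvecZ scaleN1r. Qed.

Lemma flip_tvec (k : 'I_4) y : flip (lshift m k) (tvec y) = tvec (iflip k y).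
Proof.
apply/rowP => j; rewrite [LHS]mxE !tvecE [in RHS]mxE.
by case: ifP => // _; rewrite intrN mulNr.
Qed.

Lemma lattice_tetraP e x :
  lattice (tetra_basis e) x <-> exists2 y, in_tetra e y & x = tvec y.
Proof.
split=> [[z _ <-]|[y /in_tetraP[z ->] ->]].
  exists (z *m block_mx (tetra_mx e) 0 0 1%:M); first by apply/in_tetraP; exists z.
  by rewrite /tvec map_mxM mulmxA.
by exists z => //; rewrite /tvec map_mxM mulmxA.
Qed.

Definition shift_vec (k : 'I_4) : 'rV[R]_n := tvec (axis m k).

(** In the first four integer coordinates the dual lattice is again a tetralattice,
    divided by 12. So on Fourier modes this is the projection on the frequencies
    whose [k]-th coordinate, multiplied by 12, is divisible by 3. *)
Definition average (k : 'I_4) w : form :=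
  3%:R^-1 *: (w + (translate (shift_vec k) w + translate (- shift_vec k) w)).

Definition mirror (k : 'I_4) w : form := reflect_form (lshift m k) w.

(** On Fourier modes, change the sign of the coordinate of the frequency that is
    divisible by 3. A tetracode word vanishes in exactly one coordinate, except for
    the zero word, for which coordinate 0 is chosen. *)
Definition tetra_transplant : form -> form := transplant average mirror 0.

Lemma natural_average k : natural_op (average k).
Proof.
apply: natural_scale; apply: naturalD; first exact: natural_id.
by apply: naturalD; exact: natural_translate.
Qed.

Lemma natural_mirror k : natural_op (mirror k).
Proof. exact: natural_reflect. Qed.

Lemma natural_common : natural_op (common_part average).
Proof.
apply: natural_scale; apply: naturalB; last exact: natural_id.
by apply: natural_sum => k; exact: natural_average.
Qed.

Lemma natural_transplant : natural_op tetra_transplant.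
Proof.
apply: naturalD.
  exact: (natural_comp (natural_mirror 0) natural_common).
apply: natural_sum => k.
apply: (natural_comp (natural_mirror k)).
by apply: naturalB; [exact: natural_average|exact: natural_common].
Qed.

Definition tetra_periodic e w := forall I x v, lattice (tetra_basis e) v -> w I (x + v) = w I x.

Lemma averageE k w I x : average k w I x =
  3%:R^-1 * (w I x + (w I (x + shift_vec k) + w I (x - shift_vec k))) :> R[i].
Proof. by []. Qed.

Lemma mirrorE k w I x : mirror k w I x =
  (-1) ^+ (lshift m k \in I) * w I (flip (lshift m k) x) :> R[i].
Proof. by []. Qed.

Lemma sum_formE (F : 'I_4 -> form) I x : (\sum_k F k) I x = (\sum_k F k I x : R[i]).
Proof. by rewrite !fct_sumE. Qed.

Lemma commonE w I x : common_part average w I x =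
  3%:R^-1 * ((\sum_k average k w I x) - w I x) :> R[i].
Proof.
exact: (congr1 (fun s : R[i] => 3%:R^-1 * (s - w I x)) (sum_formE (fun k => average k w) I x)).
Qed.

Lemma transplantE w I x : tetra_transplant w I x =
  mirror 0 (common_part average w) I x +
  \sum_k mirror k (average k w - common_part average w) I x :> R[i].
Proof.
exact: (congr1 (fun s : R[i] => mirror 0 (common_part average w) I x + s)
  (sum_formE (fun k => mirror k (average k w - common_part average w)) I x)).
Qed.

Lemma average_mirror j k w : average j (mirror k w) = mirror k (average j w).
Proof.
apply/funext => I; apply/funext => x; apply: etrans (averageE _ _ _ _) _.
apply: etrans (esym (mirrorE _ _ _ _)); rewrite !mirrorE averageE !flipD.
have E : flip (lshift m k) (shift_vec j) = (-1) ^+ (j == k) *: shift_vec j.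
  rewrite flip_tvec /shift_vec /axis iflip_ivec.
  have -> : (-1) ^+ (j == k) = (((-1) ^+ (j == k) : int)%:~R : R).
    by rewrite rmorphXn rmorphN1.
  rewrite -tvecZ ivecZ scaler0; congr (tvec (ivec _ _ _ _ _));
    by case: j k => [[|[|[|[|//]]]] lj] [[|[|[|[|//]]]] lk].
have EN : flip (lshift m k) (- shift_vec j) = - ((-1) ^+ (j == k) *: shift_vec j).
  by rewrite -scaleN1r flipZ E scaleN1r.
rewrite EN E; move: (flip _ x) => y; move: ((-1) ^+ (_ \in _)) => s.
case: (j == k); rewrite ?expr1 ?expr0 ?scale1r ?scaleN1r ?opprK; ring.
Qed.

Lemma tetra_periodic_eq e w I x y : tetra_periodic e w -> lattice (tetra_basis e) (x - y) ->
  w I x = w I y.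
Proof. by move=> pw /(pw I y) <-; rewrite addrC subrK. Qed.

Lemma lattice_shift3 e k : e = 1 \/ e = -1 -> lattice (tetra_basis e) (3%:R *: shift_vec k).
Proof.
move=> he; apply/lattice_tetraP; exists (3%:Z *: axis m k); first exact: in_tetra_axis3.
by rewrite tvecZ.
Qed.

Lemma average_axis e k w I x : e = 1 \/ e = -1 -> tetra_periodic e w ->
  average k w I (x + shift_vec k) = average k w I x.
Proof.
move=> he pw; rewrite !averageE addrK.
have -> : w I (x + shift_vec k + shift_vec k) = w I (x - shift_vec k).
  apply: (tetra_periodic_eq I pw).
  rewrite (_ : _ - _ = 3%:R *: shift_vec k); first exact: lattice_shift3.
  by apply/rowP => j; rewrite !mxE; ring.
congr (_ * _); rewrite addrCA [in RHS]addrA [RHS]addrC addrA [in RHS]addrC.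
ring.
Qed.

(** For distinct [j] and [k] the iterated average runs over all nine elements of the
    group of [tetracodeP], each once, whatever [j] and [k] are. *)
Lemma average_average e j k w : e = 1 \/ e = -1 -> tetra_periodic e w ->
  average j (average k w) = if j == k then average k w else common_part average w.
Proof.
move=> he pw; apply/funext => I; apply/funext => x.
case: eqVneq => [->|jk].
  rewrite averageE (average_axis _ _ _ he pw).
  rewrite -[X in _ + (_ + X)](average_axis k I (x - shift_vec k) he pw) subrK.
  by field.
have [l1 [l2 [s1 [s2 [mem un hs1 hs2 [L1 L2]]]]]] := tetracodeP m he jk.
rewrite commonE averageE !averageE.
have sum4 (F : 'I_4 -> R[i]) : \sum_i F i = F j + (F k + (F l1 + F l2)).
  transitivity (\sum_(i <- [:: j; k; l1; l2]) F i); last first.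
    by rewrite !big_cons big_nil addr0.
  rewrite (big_uniq _ un); apply: eq_bigl => i.
  by rewrite mem.
rewrite sum4 !averageE.
set a := shift_vec j; set b := shift_vec k; set c1 := shift_vec l1; set c2 := shift_vec l2.
have K1 : lattice (tetra_basis e) (a + b - s1%:~R *: c1).
  by apply/lattice_tetraP; exists (axis m j + axis m k - s1 *: axis m l1) => //;
    rewrite tvecB tvecD tvecZ.
have K2 : lattice (tetra_basis e) (a - b - s2%:~R *: c2).
  by apply/lattice_tetraP; exists (axis m j - axis m k - s2 *: axis m l2) => //;
    rewrite tvecB tvecB tvecZ.
have -> : w I (x + a + b) = w I (x + s1%:~R *: c1).
  apply: (tetra_periodic_eq I pw); congr (lattice _ _) : K1.
  by apply/rowP => i; rewrite !mxE; ring.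
have -> : w I (x - a - b) = w I (x - s1%:~R *: c1).
  apply: (tetra_periodic_eq I pw); congr (lattice _ _) : (latticeN K1).
  by apply/rowP => i; rewrite !mxE; ring.
have -> : w I (x + a - b) = w I (x + s2%:~R *: c2).
  apply: (tetra_periodic_eq I pw); congr (lattice _ _) : K2.
  by apply/rowP => i; rewrite !mxE; ring.
have -> : w I (x - a + b) = w I (x - s2%:~R *: c2).
  apply: (tetra_periodic_eq I pw); congr (lattice _ _) : (latticeN K2).
  by apply/rowP => i; rewrite !mxE; ring.
by case: hs1 hs2 => -> [] ->; rewrite ?scale1r ?scaleN1r ?opprK; field.
Qed.

Lemma tetra_transplantK e w : e = 1 \/ e = -1 -> tetra_periodic e w ->
  tetra_transplant (tetra_transplant w) = w.
Proof.
move=> he pw; apply: transplant_involutive => //.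
- by move=> k; exact: natural_lin (natural_average k).
- by move=> k; exact: natural_lin (natural_mirror k).
- by move=> k u; exact: reflect_formK.
- exact: average_mirror.
- by move=> j k; exact: average_average pw.
Qed.

End TetraTorus.

(** * Isospectrality *)

Lemma form_dim_eq (R : realType) (n : nat) (E E' : set (dform R n)) :
  (forall k, (exists e : 'I_k -> dform R n, form_basis E e) <->
             (exists e : 'I_k -> dform R n, form_basis E' e)) ->
  form_dim E = form_dim E'.
Proof.
move=> H; rewrite /form_dim; congr xget; apply/seteqP.
by split=> _ [k fb <-]; exists k => //; apply/H.
Qed.

Section TransplantForms.
Variables (R : realType) (m : nat).
Local Notation n := (4 + m)%N.
Variable d : 'rV[R]_n.
Local Notation form := ({set 'I_n} -> 'rV[R]_n -> R[i]^o).
Implicit Types (w u : form).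
Hypothesis d_neq0 : forall j, d 0 j != 0.

Local Notation T := (tetra_transplant d).
Local Notation periodic := (tetra_periodic d).

Lemma periodic_average e k w : periodic e w -> periodic e (average d k w).
Proof.
move=> pw I x v Lv; rewrite !averageE ![x + v + _]addrAC.
by rewrite !(pw I _ v Lv).
Qed.

Lemma periodic_lin e a w u : periodic e w -> periodic e u -> periodic e (a *: w + u).
Proof.
move=> pw pu I x v Lv; transitivity (a * w I (x + v) + u I (x + v) : R[i]); first by [].
by rewrite pw // pu.
Qed.

(** The form in which translation invariance of the common part is read off. *)
Lemma common_average e j k w : e = 1 \/ e = -1 -> periodic e w -> j != k ->
  common_part (average d) w = average d j (average d k w).
Proof. by move=> he pw jk; rewrite (average_average j k he pw) (negPf jk). Qed.

Lemma common_axis e k w I x : e = 1 \/ e = -1 -> periodic e w ->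
  common_part (average d) w I (x + shift_vec d k) = common_part (average d) w I x.
Proof.
move=> he pw; have [k' kk'] : exists k', k != k'.
  by exists (if k == 0 then 1 else 0); case: (eqVneq k 0) => [->|].
rewrite (common_average he pw kk').
by apply: (average_axis k I x he); exact: periodic_average.
Qed.

Lemma shift_multiple (f : 'rV[R]_n -> R[i]) v (c : int) x :
  (forall y, f (y + v) = f y) -> f (x + c%:~R *: v) = f x.
Proof.
move=> H; have Hn (k : nat) y : f (y + k%:R *: v) = f y.
  elim: k y => [|k IH] y; first by rewrite scale0r addr0.
  by rewrite -natr1 scalerDl scale1r addrA H IH.
case: c => k; first exact: Hn.
rewrite NegzE -(Hn k.+1); congr f.
by rewrite -addrA rmorphN scaleNr addNr addr0.
Qed.

(** The reflection exchanges the two lattices up to multiples of [shift_vec d k], see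
    [in_tetra_flip]; so it exchanges the forms that are moreover invariant under
    this vector. *)
Lemma periodic_mirror e k w : e = 1 \/ e = -1 -> periodic e w ->
  (forall I x, w I (x + shift_vec d k) = w I x) -> periodic (- e) (mirror k w).
Proof.
move=> he pw sw I x v /lattice_tetraP[y Ly ->].
have he' : - e = 1 \/ - e = -1 by case: he => ->; [right|left].
have [c Lc] := in_tetra_flip k he' Ly; rewrite opprK in Lc.
rewrite !mirrorE flipD flip_tvec; congr (_ * _).
rewrite -[LHS](@shift_multiple (w I) (shift_vec d k) c _ (sw I)) -addrA -tvecZ -tvecD.
by apply: pw; apply/lattice_tetraP; exists (iflip k y + c *: axis m k).
Qed.

Lemma periodic_transplant e w : e = 1 \/ e = -1 -> periodic e w -> periodic (- e) (T w).
Proof.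
move=> he pw.
have pk k : periodic e (average d k w) by exact: periodic_average.
have pc : periodic e (common_part (average d) w).
  have -> := common_average he pw (isT : (0 : 'I_4) != 1).
  by apply: periodic_average; exact: periodic_average.
have p0 : periodic (- e) (mirror 0 (common_part (average d) w)).
  by apply: periodic_mirror => // I x; exact: (common_axis 0 I x he pw).
have pm k : periodic (- e) (mirror k (average d k w - common_part (average d) w)).
  apply: periodic_mirror => //.
    by have := periodic_lin (-1) pc (pk k); rewrite scaleN1r addrC.
  move=> I x; transitivity (average d k w I (x + shift_vec d k) -
     common_part (average d) w I (x + shift_vec d k) : R[i]); first by [].
  by rewrite (average_axis _ _ _ he pw) (common_axis _ _ _ he pw).
move=> I x v Lv; rewrite !transplantE p0 //; congr (_ + _).
by apply: eq_bigr => k _; exact: pm.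
Qed.

Lemma tetra_basis_unit e : e = 1 \/ e = -1 -> tetra_basis d e \in unitmx.
Proof.
move=> he; rewrite unitmx_mul; apply/andP; split; last first.
  rewrite unitmxE det_diag unitfE; apply/prodf_neq0 => j _; exact: d_neq0.
rewrite unitmxE unitfE det_map_mx intr_eq0 det_lblock det1 mulr1.
apply/negP => /eqP D0.
have : tetra_mx e *m (tetra_mx e)^T = 12%:M.
  apply/matrixP => i j; rewrite !mxE !big_ord_recl big_ord0 !mxE.
  by case: i j => [[|[|[|[|//]]]] li] [[|[|[|[|//]]]] lj]; case: he => ->.
move=> /(congr1 determinant); rewrite det_mulmx D0 mul0r det_scalar => /eqP.
by rewrite eq_sym expf_eq0.
Qed.

Lemma torus_form_periodic e w :
  torus_form (tetra_basis d e) w <-> smooth_form w /\ periodic e w.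
Proof.
rewrite torus_formP; split=> [H|[sw pw] I].
  split=> [I|I x v Lv]; first by case: (H I).
  by apply: (H I).2; exact: torus_eq_lattice.
split; first exact: sw.
move=> x y xy; exact: tetra_periodic_eq pw xy.
Qed.

Lemma torus_form_transplant e w : e = 1 \/ e = -1 ->
  torus_form (tetra_basis d e) w -> torus_form (tetra_basis d (- e)) (T w).
Proof.
move=> he /torus_form_periodic[sw pw]; apply/torus_form_periodic; split.
  exact: (natural_smooth (natural_transplant d)).
exact: periodic_transplant.
Qed.

Lemma transplant0 : T 0 = 0.
Proof.
have := natural_lin (natural_transplant d) (-1) 0 0.
by rewrite scaler0 add0r scaleN1r addNr.
Qed.

Definition F_formula (alpha beta : R) (w : form) : form :=
  alpha%:C *: (ext_d (divergence w) : form) + beta%:C *: (divergence (ext_d w) : form).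

Lemma F_opE e alpha beta w : e = 1 \/ e = -1 -> torus_form (tetra_basis d e) w ->
  F_op (tetra_basis d e) alpha beta w = F_formula alpha beta w.
Proof.
move=> he tw; have uB := tetra_basis_unit he.
apply/funext => J; apply/funext => x; rewrite /F_op codiffE // codiffE //.
exact: torus_form_ext_d.
Qed.

Lemma F_formula_transplant alpha beta w : smooth_form w ->
  F_formula alpha beta (T w) = T (F_formula alpha beta w).
Proof.
move=> sw; have nT := natural_transplant d; rewrite /F_formula.
rewrite (natural_div nT sw) (natural_d nT sw).
rewrite (natural_d nT (smooth_divergence sw)) (natural_div nT (smooth_ext_d sw)).
rewrite (natural_lin nT); congr (_ + _).
by have := natural_lin nT beta%:C (divergence (ext_d w)) 0; rewrite transplant0 !addr0.
Qed.

(** Eigenforms go to eigenforms because [T] commutes with the exterior derivative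
    and the codifferential. *)
Lemma eigenspace_transplant e alpha beta p lambda w : e = 1 \/ e = -1 ->
  F_eigenspace (tetra_basis d e) alpha beta p lambda w ->
  F_eigenspace (tetra_basis d (- e)) alpha beta p lambda (T w).
Proof.
move=> he [[tw deg] eig].
have he' : - e = 1 \/ - e = -1 by case: he => ->; [right|left].
have tTw := torus_form_transplant he tw.
have [sw _] := (torus_form_periodic _ _).1 tw.
split; first split=> // I x Ip.
  have a0 k y : average d k w I y = 0 by rewrite averageE !deg // !addr0 mulr0.
  have c0 y : common_part (average d) w I y = 0.
    by rewrite commonE deg // big1 ?subr0 ?mulr0 // => k _; exact: a0.
  rewrite transplantE mirrorE c0 mulr0 add0r big1 // => k _.
  rewrite mirrorE; transitivity ((-1) ^+ (lshift m k \in I) *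
    (average d k w I (flip (lshift m k) x) -
     common_part (average d) w I (flip (lshift m k) x)) : R[i]); first by [].
  by rewrite a0 c0 subrr mulr0.
move=> J x; rewrite (F_opE alpha beta he' tTw) (F_formula_transplant alpha beta sw).
have -> : F_formula alpha beta w = lambda *: (w : form).
  apply/funext => K; apply/funext => y.
  by have := eig K y; rewrite (F_opE alpha beta he tw).
have := natural_lin (natural_transplant d) lambda w 0.
by rewrite transplant0 !addr0 => ->.
Qed.

Lemma transplant_comb k (c : 'I_k -> R[i]) (f : 'I_k -> form) :
  T (form_comb c f) = form_comb c (fun i => T (f i)).
Proof.
have E (g : 'I_k -> form) : form_comb c g = \sum_i c i *: g i.
  by apply/funext => J; apply/funext => x; rewrite !fct_sumE.
rewrite !E; elim/big_rec2: _ => [|i u v _ <-]; first exact: transplant0.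
exact: (natural_lin (natural_transplant d)).
Qed.

Lemma transplant_basis e alpha beta p lambda k (f : 'I_k -> form) : e = 1 \/ e = -1 ->
  form_basis (F_eigenspace (tetra_basis d e) alpha beta p lambda) f ->
  form_basis (F_eigenspace (tetra_basis d (- e)) alpha beta p lambda) (fun i => T (f i)).
Proof.
move=> he [fE free span].
have he' : - e = 1 \/ - e = -1 by case: he => ->; [right|left].
have TK w : torus_form (tetra_basis d e) w -> T (T w) = w.
  by move=> /torus_form_periodic[_ pw]; exact: tetra_transplantK pw.
have TK' w : torus_form (tetra_basis d (- e)) w -> T (T w) = w.
  by move=> /torus_form_periodic[_ pw]; exact: tetra_transplantK pw.
split=> [i|c H|w Ew].
- exact: eigenspace_transplant.
- apply: free; rewrite -[LHS]TK; last first.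
    apply/torus_formP => I; apply: torus_cfun_sum => i _; apply: torus_cfunM.
      exact: torus_cfun_cst.
    by have [[/torus_formP tf _] _] := fE i.
  by rewrite transplant_comb H; exact: transplant0.
- have := eigenspace_transplant he' Ew; rewrite opprK => /span[c E].
  by exists c; rewrite -transplant_comb -E TK' //; case: Ew => [[]].
Qed.

Lemma tetra_isospectral alpha beta p :
  F_isospectral (tetra_basis d 1) (tetra_basis d (-1)) alpha beta p.
Proof.
move=> lambda; apply: form_dim_eq => k; split=> -[f fb]; exists (fun i => T (f i)).
  by apply: transplant_basis fb; left.
by rewrite -[1]opprK; apply: transplant_basis fb; right.
Qed.

End TransplantForms.

(** * Non-isometry *)

(** Compare the parities of the [p]-adic valuations. *)
Lemma sqr_eq_mul_sqr (p N : nat) (x y : int) : prime p -> odd (logn p N) ->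
  x ^+ 2 = N%:Z * y ^+ 2 -> x = 0 /\ y = 0.
Proof.
move=> pp oN E.
have N0 : (0 < N)%N by case: N oN {E}; rewrite ?logn0.
have y0 : y = 0.
  apply/eqP/negPn/negP => yn0.
  have yp : (0 < `|y|)%N by rewrite absz_gt0.
  have En : (`|x| ^ 2 = N * `|y| ^ 2)%N by move/(congr1 absz): E; rewrite abszM !abszX.
  have := congr1 (odd \o logn p) En; rewrite /= lognM // ?expn_gt0 ?yp // !lognX.
  by rewrite oddD !oddM /= addbF oN.
by move: E; rewrite y0 expr0n mulr0 => /eqP; rewrite sqrf_eq0 => /eqP.
Qed.

Section Independence.
Variable R : realType.

Let s2 : R := Num.sqrt 2.
Let s3 : R := Num.sqrt 3.

Lemma sqrt2_independent (p q : int) : p%:~R + q%:~R * s2 = 0 -> p = 0 /\ q = 0.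
Proof.
move=> E; apply: (@sqr_eq_mul_sqr 2 2) => //.
apply: (@intr_inj R); rewrite rmorphM ?rmorphXn /=.
have s22 : s2 ^+ 2 = 2 by rewrite sqr_sqrtr.
have -> : p%:~R = - (q%:~R * s2) :> R by apply/eqP; rewrite -addr_eq0 E.
transitivity (q%:~R ^+ 2 * s2 ^+ 2 : R); first by ring.
by rewrite s22; ring.
Qed.

(** Isolating [sqrt 3] and squaring gives two integer relations, which imply
    [p^2 - 2 q^2 = +- 3 (r^2 - 2 s^2)]. For each sign what remains are equations
    [x^2 = N y^2] with [N] equal to 3 or 6. *)
Lemma sqrt23_independent (p q r s : int) :
  p%:~R + q%:~R * s2 + r%:~R * s3 + s%:~R * (s2 * s3) = 0 ->
  [/\ p = 0, q = 0, r = 0 & s = 0].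
Proof.
move=> E.
have s22 : s2 ^+ 2 = 2 by rewrite sqr_sqrtr.
have s33 : s3 ^+ 2 = 3 by rewrite sqr_sqrtr.
have [E1 E2] : p ^+ 2 + 2 * q ^+ 2 - 3 * r ^+ 2 - 6 * s ^+ 2 = 0 /\ 2 * p * q - 6 * r * s = 0.
  apply: sqrt2_independent.
  transitivity ((p%:~R + q%:~R * s2) ^+ 2 - (r%:~R + s%:~R * s2) ^+ 2 * s3 ^+ 2 : R).
    by rewrite s33; ring: s22.
  have -> : p%:~R + q%:~R * s2 = - ((r%:~R + s%:~R * s2) * s3).
    by apply/eqP; rewrite -addr_eq0 -[X in _ == X]E; apply/eqP; ring.
  by rewrite sqrrN exprMn subrr.
have E3 : (p ^+ 2 - 2 * q ^+ 2) ^+ 2 = (3 * (r ^+ 2 - 2 * s ^+ 2)) ^+ 2.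
  have Epq : p * q = 3 * r * s by lia.
  have Esum : p ^+ 2 + 2 * q ^+ 2 = 3 * (r ^+ 2 + 2 * s ^+ 2) by lia.
  transitivity ((p ^+ 2 + 2 * q ^+ 2) ^+ 2 - 8 * (p * q) ^+ 2); first by ring.
  by rewrite Epq Esum; ring.
have := eqf_sqr (p ^+ 2 - 2 * q ^+ 2) (3 * (r ^+ 2 - 2 * s ^+ 2)); rewrite E3 eqxx.
move=> /esym/orP[]/eqP E4.
- have [|p0 r0] := @sqr_eq_mul_sqr 3 3 p r isT isT; first by lia.
  have [|q0 s0] := @sqr_eq_mul_sqr 3 3 q s isT isT; first by lia.
  by split.
- have [|p0 s0] := @sqr_eq_mul_sqr 2 6 p s isT isT; first by lia.
  have [|q0 r0] := @sqr_eq_mul_sqr 2 6 (2 * q) r isT isT; first by rewrite exprMn; lia.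
  by split=> //; lia.
Qed.

End Independence.

Section NonIsometric.
Variables (R : realType) (m : nat).
Local Notation n := (4 + m)%N.

(** The squared lengths of the axes: linearly independent over the rationals on the
    first four axes, and repeating the fourth one on the remaining axes. *)
Definition weights : 'rV[R]_n :=
  row_mx (row4 1 (Num.sqrt 2) (Num.sqrt 3) (Num.sqrt 2 * Num.sqrt 3))
         (const_mx (Num.sqrt 2 * Num.sqrt 3)).

Definition scales : 'rV[R]_n := map_mx Num.sqrt weights.

Lemma weights_gt0 j : 0 < weights 0 j.
Proof.
have [s2 s3] : 0 < Num.sqrt 2 :> R /\ 0 < Num.sqrt 3 :> R by rewrite !sqrtr_gt0.
rewrite mxE; case: splitP => i _; rewrite mxE; last by rewrite mulr_gt0.
by case: i => [[|[|[|[|//]]]] li] //=; rewrite mulr_gt0.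
Qed.

Lemma scales_neq0 j : scales 0 j != 0.
Proof. by rewrite mxE gt_eqF // sqrtr_gt0 weights_gt0. Qed.

Lemma inner_tvec (y0 y1 y2 y3 z0 z1 z2 z3 : int) (t u : 'rV[int]_m) :
  (tvec scales (ivec y0 y1 y2 y3 t) *m (tvec scales (ivec z0 z1 z2 z3 u))^T) 0 0 =
  (y0 * z0)%:~R + (y1 * z1)%:~R * Num.sqrt 2 + (y2 * z2)%:~R * Num.sqrt 3 +
  (y3 * z3 + \sum_i t 0 i * u 0 i)%:~R * (Num.sqrt 2 * Num.sqrt 3).
Proof.
have E j : tvec scales (ivec y0 y1 y2 y3 t) 0 j * tvec scales (ivec z0 z1 z2 z3 u) 0 j =
   (ivec y0 y1 y2 y3 t 0 j * ivec z0 z1 z2 z3 u 0 j)%:~R * weights 0 j.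
  rewrite !tvecE mulrACA rmorphM; congr (_ * _).
  by rewrite mxE -expr2 sqr_sqrtr // ltW // weights_gt0.
rewrite mxE.
transitivity (\sum_j (ivec y0 y1 y2 y3 t 0 j * ivec z0 z1 z2 z3 u 0 j)%:~R * weights 0 j).
  by apply: eq_bigr => j _; rewrite -E; congr (_ * _); exact: mxE.
rewrite big_split_ord /= !big_ord_recl big_ord0.
under [X in _ + X]eq_bigr do rewrite /ivec /weights !row_mxEr [const_mx _ _ _]mxE.
rewrite -mulr_suml -rmorph_sum /ivec /weights !row_mxEl !mxE /=.
by rewrite [in RHS]rmorphD mulrDl mulr1 addr0 !addrA.
Qed.

Lemma inner_tvec_inj (a0 a1 a2 a3 b0 b1 b2 b3 : int) :
  a0%:~R + a1%:~R * Num.sqrt 2 + a2%:~R * Num.sqrt 3 + a3%:~R * (Num.sqrt 2 * Num.sqrt 3) =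
  b0%:~R + b1%:~R * Num.sqrt 2 + b2%:~R * Num.sqrt 3 + b3%:~R * (Num.sqrt 2 * Num.sqrt 3) :> R ->
  [/\ a0 = b0, a1 = b1, a2 = b2 & a3 = b3].
Proof.
move=> E; have [] := @sqrt23_independent R (a0 - b0) (a1 - b1) (a2 - b2) (a3 - b3).
  rewrite !rmorphB /= !mulrBl.
  by move/eqP: E; rewrite -subr_eq0 => /eqP <-; ring.
by split; lia.
Qed.

(** An isometry gives a linear map that preserves inner products and, the weights
    being independent, preserves the contribution of each weight. So it acts on the
    first two vectors of the basis by changing signs of coordinates. The tetracode
    forces these signs to be equal, and then the images of the two vectors violate
    the parity condition that distinguishes the lattices. *)
Lemma tetra_not_isometric :
  ~ tori_isometric (tetra_basis scales 1) (tetra_basis scales (-1)).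
Proof.
move=> [f [g fg]].
have uB : tetra_basis scales (-1) \in unitmx.
  by apply: tetra_basis_unit; [exact: scales_neq0|right].
have [A [AA LA]] := torus_isometry_linear uB fg.
have inner (x y : 'rV[R]_n) : (x *m A) *m (y *m A)^T = x *m y^T.
  by rewrite trmx_mul mulmxA -[x *m A *m _]mulmxA AA mulmx1.
pose u := ivec 3 (-1) (-1) (-1) (0 : 'rV[int]_m).
pose v := ivec 1 3 (-1) 1 (0 : 'rV[int]_m).
have Lu : lattice (tetra_basis scales 1) (tvec scales u).
  by apply/lattice_tetraP; exists u => //; exists 1, 0, 0, 0, 0; congr ivec.
have Lv : lattice (tetra_basis scales 1) (tvec scales v).
  by apply/lattice_tetraP; exists v => //; exists 0, 1, 0, 0, 0; congr ivec.
have /lattice_tetraP[_ [a [b [c [d [t ->]]]]] Eu] := LA _ Lu.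
have /lattice_tetraP[_ [a' [b' [c' [d' [t' ->]]]]] Ev] := LA _ Lv.
have Iuu := inner (tvec scales u) (tvec scales u).
have Iuv := inner (tvec scales u) (tvec scales v).
have Ivv := inner (tvec scales v) (tvec scales v).
rewrite Eu in Iuu Iuv; rewrite Ev in Iuv Ivv.
move: Iuu Iuv Ivv => /(congr1 (fun M : 'M[R]_1 => M 0 0)) Iuu
  /(congr1 (fun M : 'M[R]_1 => M 0 0)) Iuv /(congr1 (fun M : 'M[R]_1 => M 0 0)) Ivv.
rewrite !inner_tvec in Iuu Iuv Ivv.
have S0 (w1 w2 : 'rV[int]_m) : w1 = 0 -> \sum_i w1 0 i * w2 0 i = 0.
  by move=> ->; apply: big1 => i _; rewrite mxE mul0r.
rewrite !(S0 0) // in Iuu Iuv Ivv.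
have [uu0 uu1 uu2 uu3] := inner_tvec_inj Iuu.
have [uv0 uv1 uv2 uv3] := inner_tvec_inj Iuv.
have [vv0 vv1 vv2 vv3] := inner_tvec_inj Ivv.
have tt0 : 0 <= \sum_i t 0 i * t 0 i by apply: sumr_ge0 => i _; exact: sqr_ge0.
(* The last weight is shared by the fourth axis and the remaining ones. All four
   tetralattice coordinates have the same parity, so the fourth one is odd and
   takes the whole squared length 1. *)
set X3 := - a + b - c + 3 * -1 * d in uu3 uv3.
have X3n0 : X3 != 0.
  apply/eqP => X30; have : (3 * -1 * a + b + c + d) ^+ 2 = 9 by rewrite expr2 uu0.
  by rewrite /X3 in X30; move=> ?; clear -X30 uu0; nia.
have X31 : X3 * X3 = 1.
  by have : 0 < X3 * X3 by [rewrite lt_def mulf_neq0 // sqr_ge0]; move: uu3 tt0; lia.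
have t0 : t = 0.
  apply/rowP => i; rewrite mxE; apply/eqP; rewrite -sqrf_eq0 expr2.
  have S : \sum_i t 0 i * t 0 i = 0 by lia.
  move/eqP: S; rewrite psumr_eq0; last by move=> j _; exact: sqr_ge0.
  by move=> /allP/(_ i (mem_index_enum _)).
rewrite t0 S0 // in uv3.
have sq1 (x : int) : x * x = 1 -> x = 1 \/ x = -1.
  by move=> /eqP; rewrite -expr2 sqrf_eq1 => /orP[] /eqP; [left|right].
have sq3 (x : int) : x * x = 3 * 3 -> x = 3 \/ x = -3.
  by move=> /eqP; rewrite -!expr2 eqf_sqr => /orP[] /eqP; [left|right].
clear - sq1 sq3 uu0 uu1 uu2 X31 uv0 uv1 uv2 uv3.
rewrite mulrNN mulr1 in uu1; rewrite mulrNN mulr1 in uu2.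
case: (sq3 _ uu0) (sq1 _ uu1) (sq1 _ uu2) (sq1 _ X31) => e0 [] e1 [] e2 [] e3;
  rewrite ?e0 ?e1 ?e2 ?e3 in uv0 uv1 uv2 uv3; rewrite /X3 in e3; lia.
Qed.

End NonIsometric.

(** * The theorem *)

Unset Implicit Arguments.

Theorem proposition3p18 (R : realType) (alpha beta : R) (n p : nat)
    (halpha : 0 < alpha) (hbeta : 0 < beta)
    (hn : (4 <= n)%N) (hp : (1 <= p <= n)%N) :
  exists B1 B2 : 'M[R]_n,
    [/\ B1 \in unitmx,
        B2 \in unitmx,
        F_isospectral B1 B2 alpha beta p &
        ~ tori_isometric B1 B2].
Proof.
have [m ->] : exists m, n = (4 + m)%N by exists (n - 4)%N; rewrite subnKC.
exists (tetra_basis (scales R m) 1), (tetra_basis (scales R m) (-1)); split.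
- by apply: tetra_basis_unit; [exact: scales_neq0|left].
- by apply: tetra_basis_unit; [exact: scales_neq0|right].
- by apply: tetra_isospectral; exact: scales_neq0.
- exact: tetra_not_isometric.
Qed.
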